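(* Let $(\eta;\xi_i,1\le i\le^*N)$ have a given joint law with $N\in\{0,1,\dots,\infty\}$ random, $0\le\xi_i<1$, $\eta\ge0$ and $\mathbb E[\eta^p]<\infty$ for all $p\ge1$. For $p\ge1$ let $c(p)=\sum_{i\ge1}\mathbb E[\xi_i^p]\in[0,\infty]$ (with $\xi_i:=0$ for $i>N$), and suppose $c(p)<\infty$ for some $p\ge1$. Let $T$ be the map induced by the recursive distributional equation $$X\stackrel d=\eta+\sup_{i\le^*N}\xi_iX_i\qquad\text{on }[0,\infty).$$ (a) The discounted tree sum $X$ defined below is a.s. finite, its law $\mu$ is a solution of the equation with all moments finite, the associated invariant RTP is endogenous, and $T^n(\delta_0)\to\mu$ weakly. (b) For any $p\ge1$ with $c(p)<1$, $T$ maps $\mathcal F_p$ into itself and is a strict contraction on $(\mathcal F_p,d_p)$ with $d_p(T\mu_1,T\mu_2)\le c(p)^{1/p}d_p(\mu_1,\mu_2)$; consequently $\mu$ is the unique solution with finite $p$-th moment and $T^n(\mu_0)\to\mu$ for every $\mu_0\in\mathcal F_p$.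
   Context: $i\le^*N$ means $i\le N$ if $N<\infty$ and $i<\infty$ if $N=\infty$; the sup over an empty set is $0$. $T$ sends a law $\mu$ on $[0,\infty)$ to the law of $\eta+\sup_{i\le^*N}\xi_iX_i$ with $X_i$ i.i.d. $\mu$ independent of $(\eta;\xi_i)$. Discounted tree sum: let $\mathcal T$ be the Galton–Watson tree with vertices finite words of positive integers, where each vertex $\mathbf i$ carries an independent copy $(\eta_{\mathbf i};\xi_{\mathbf ij},j\le^*N_{\mathbf i})$ of $(\eta;\xi_j,j\le^*N)$ and has children $\mathbf ij$, $j\le^*N_{\mathbf i}$; $\xi_{\mathbf ij}$ is the weight of the edge $(\mathbf i,\mathbf ij)$. For a finite path $\pi=(\emptyset=v_0,v_1,\dots,v_k)$ from the root in $\mathcal T$ set $W(\pi)=\sum_{d=0}^k\eta_{v_d}\prod_{j=1}^d\xi_{v_j}$ (where $\xi_{v_j}$ is the weight of edge $(v_{j-1},v_j)$), and $X=\sup_\pi W(\pi)$. $\mathcal F_p$ is the set of laws on $[0,\infty)$ with finite $p$-th moment and $d_p(\mu,\nu)=\inf\{(\mathbb E|Z-W|^p)^{1/p}:Z\sim\mu,W\sim\nu\}$ the Wasserstein metric. Invariant RTP and endogeny: a family $(X_{\mathbf i})$ indexed by all finite words, each with law $\mu$, with $X_{\mathbf i}=\eta_{\mathbf i}+\sup_{j\le^*N_{\mathbf i}}\xi_{\mathbf ij}X_{\mathbf ij}$ a.s., generation-$d$ variables i.i.d. and independent of the data at generations $<d$; endogenous means $X_\emptyset$ is measurable w.r.t.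 the $\sigma$-field generated by all the data. *)

(* Defs.v *)
From HB Require Import structures.
From mathcomp Require Import all_boot all_order all_algebra.
From mathcomp Require Import all_classical all_reals all_analysis.
From mathcomp Require Import measurable_realfun.
From mathcomp Require Import finmap.
Import Order.TTheory GRing.Theory Num.Theory.
Import numFieldNormedType.Exports.

Set Implicit Arguments.
Unset Strict Implicit.
Unset Printing Implicit Defensive.

Local Open Scope classical_set_scope.
Local Open Scope ring_scope.

Section Defs.
Context {R : realType}.

(* Convention: a child label / index [i : nat] stands for the positive
   integer i.+1.  [le_star i n] means  "i.+1 <=* N"  where N takes values
   in {0,1,...} U {+oo} (encoded in \bar R). *)
Definition le_star (i : nat) (n : \bar R) : Prop := ((i.+1)%:R%:E <= n)%E.

(* supremum over a set of nonnegative reals, with sup of the empty set = 0 *)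
Definition sup_nn (S : set (\bar R)) : \bar R := ereal_sup (0%E |` S).

Section OnSpace.
Context {d : measure_display} {Om : measurableType d}.

Definition sigmaR (f : Om -> R) : set (set Om) :=
  [set f @^-1` B | B in [set B : set R | measurable B]].
Definition sigmaER (f : Om -> \bar R) : set (set Om) :=
  [set f @^-1` B | B in [set B : set (\bar R) | measurable B]].

Definition data_gens (eta : Om -> R) (xi : nat -> Om -> R) (N : Om -> \bar R)
  : set (set Om) :=
  sigmaR eta `|` (\bigcup_i sigmaR (xi i)) `|` sigmaER N.

Definition data_sigma eta xi N : set (set Om) := <<s data_gens eta xi N >>.

Definition data_meas (eta : Om -> R) (xi : nat -> Om -> R) (N : Om -> \bar R)
  : Prop :=
  [/\ measurable_fun setT eta, (forall i, measurable_fun setT (xi i))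
    & measurable_fun setT N].

Definition measurable_wrt (G : set (set Om)) (g : Om -> R) : Prop :=
  forall B : set R, measurable B -> G (g @^-1` B).

Definition indep_family (P : probability Om R) {I : choiceType}
  (F : I -> set (set Om)) : Prop :=
  forall (J : {fset I}) (A : I -> set Om),
    (forall i, i \in J -> F i (A i)) ->
    P (\bigcap_(i in [set` J]) A i) = (\prod_(i <- J) P (A i))%E.

Definition law_is (P : probability Om R) (Y : Om -> R)
  (mu : probability R R) : Prop :=
  forall B : set R, measurable B -> P (Y @^-1` B) = mu B.

(* the law of an extended-real random variable is the law mu on R
   (this forces Y to be a.s. finite) *)
Definition elaw_is (P : probability Om R) (Y : Om -> \bar R)
  (mu : probability R R) : Prop :=
  forall B : set R, measurable B -> P [set w | (EFin @` B) (Y w)] = mu B.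

Definition data_event (eta : Om -> R) (xi : nat -> Om -> R) (N : Om -> \bar R)
  (n : nat) (B0 : set R) (B : nat -> set R) (BN : set (\bar R)) : set Om :=
  [set w | [/\ B0 (eta w), (forall i, (i < n)%N -> B i (xi i w)) & BN (N w)]].

End OnSpace.

Definition same_data_law {d1} {O1 : measurableType d1} (P1 : probability O1 R)
  eta1 xi1 N1 {d2} {O2 : measurableType d2} (P2 : probability O2 R)
  eta2 xi2 N2 : Prop :=
  forall (n : nat) (B0 : set R) (B : nat -> set R) (BN : set (\bar R)),
    measurable B0 -> (forall i, measurable (B i)) -> measurable BN ->
    P1 (data_event eta1 xi1 N1 n B0 B BN) = P2 (data_event eta2 xi2 N2 n B0 B BN).

Section Base.
Context {d0 : measure_display} {O0 : measurableType d0} (P0 : probability O0 R)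
  (eta : O0 -> R) (xi : nat -> O0 -> R) (N : O0 -> \bar R).

Definition cp (p : R) : \bar R :=
  (\sum_(i <oo) \int[P0]_w
      (\1_[set w' | le_star i (N w')] w * (xi i w `^ p))%:E)%E.

Definition Trel (mu nu : probability R R) : Prop :=
  forall (d : measure_display) (Om : measurableType d) (P : probability Om R)
    (eta1 : Om -> R) (xi1 : nat -> Om -> R) (N1 : Om -> \bar R)
    (X : nat -> Om -> R),
  data_meas eta1 xi1 N1 -> (forall i, measurable_fun setT (X i)) ->
  same_data_law P0 eta xi N P eta1 xi1 N1 ->
  (forall i, law_is P (X i) mu) ->
  indep_family P (fun o : option nat =>
     if o is Some i then sigmaR (X i) else data_sigma eta1 xi1 N1) ->
  elaw_is P (fun w => (eta1 w)%:E +
     sup_nn [set (xi1 i w * X i w)%:E | i in [set i | le_star i (N1 w)]])%E nu.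

Definition Tchain (mu0 : set R -> \bar R) (nu : nat -> probability R R) : Prop :=
  (forall A, measurable A -> nu 0%N A = mu0 A) /\
  (forall n, Trel (nu n) (nu n.+1)).

Definition tree_data {d} {Om : measurableType d} (P : probability Om R)
  (etaT : seq nat -> Om -> R) (xiT : seq nat -> nat -> Om -> R)
  (NT : seq nat -> Om -> \bar R) : Prop :=
  [/\ (forall w, data_meas (etaT w) (xiT w) (NT w)),
      (forall w, same_data_law P0 eta xi N P (etaT w) (xiT w) (NT w))
    & indep_family P (fun w => data_sigma (etaT w) (xiT w) (NT w))].

Definition invariant_RTP (mu : probability R R) {d} {Om : measurableType d}
  (P : probability Om R) etaT xiT NT (X : seq nat -> Om -> R) : Prop :=
  [/\ tree_data P etaT xiT NT,
      (forall w, measurable_fun setT (X w)),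
      (forall w, law_is P (X w) mu),
      (forall w, {ae P, forall om, ((X w om)%:E = (etaT w om)%:E +
          sup_nn [set (xiT w j om * X (rcons w j) om)%:E
                | j in [set j | le_star j (NT w om)]])%E}) &
      (* generation-n variables are (i.i.d. and) independent of the data at
         generations < n *)
      (forall n : nat, indep_family P (fun o : option (seq nat) =>
          match o with
          | Some w => if size w == n then sigmaR (X w)
                      else [set A | A = set0 \/ A = setT]
          | None => <<s \bigcup_(w in [set w : seq nat | (size w < n)%N])
                         data_gens (etaT w) (xiT w) (NT w) >>
          end))].

Definition endogenous (mu : probability R R) : Prop :=
  forall (d : measure_display) (Om : measurableType d) (P : probability Om R)
    etaT xiT NT (X : seq nat -> Om -> R),
  invariant_RTP mu P etaT xiT NT X ->
  exists g : Om -> R,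
    measurable_wrt <<s \bigcup_(w in [set: seq nat])
                         data_gens (etaT w) (xiT w) (NT w) >> g /\
    {ae P, forall om, X [::] om = g om}.

End Base.

Definition in_tree {d} {Om : measurableType d} (NT : seq nat -> Om -> \bar R)
  (om : Om) (v : seq nat) : Prop :=
  forall k, (k < size v)%N -> le_star (nth 0%N v k) (NT (take k v) om).

Definition Wpath {d} {Om : measurableType d} (etaT : seq nat -> Om -> R)
  (xiT : seq nat -> nat -> Om -> R) (om : Om) (v : seq nat) : R :=
  \sum_(k < (size v).+1)
     etaT (take k v) om * \prod_(j < k) xiT (take j v) (nth 0%N v j) om.

Definition tree_sum {d} {Om : measurableType d} etaT xiT NT (om : Om) : \bar R :=
  ereal_sup [set (Wpath etaT xiT om v)%:E | v in in_tree NT om].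

Definition Fp (p : R) (mu : probability R R) : Prop :=
  mu [set x : R | x < 0] = 0%E /\ (\int[mu]_x (`|x| `^ p)%:E < +oo)%E.

Definition coupling (mu nu : probability R R) (pi : probability (R * R)%type R)
  : Prop :=
  forall A : set R, measurable A ->
    pi (A `*` setT) = mu A /\ pi (setT `*` A) = nu A.

Definition dW (p : R) (mu nu : probability R R) : \bar R :=
  ereal_inf [set ((\int[pi]_z (`|z.1 - z.2| `^ p)%:E) `^ p^-1)%E
            | pi in coupling mu nu].

Definition weak_cvg (nu : nat -> probability R R) (mu : probability R R) : Prop :=
  forall f : R -> R, continuous f -> (exists M, forall x, `|f x| <= M) ->
    (fun n => \int[nu n]_x (f x)%:E)%E @ \oo --> (\int[mu]_x (f x)%:E)%E.

End Defs.

(* Main.v *)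
(** Both the RDE map and the law of the tree sum depend only on product laws, so
    they can be computed on canonical spaces: the data of a root together with
    an i.i.d. sequence of leaves.  Grafting i.i.d. copies of the tree below a
    root gives the tree again; hence the law [mu] of the tree sum solves the
    equation, and the sums over paths with at most [n] vertices have law
    [T^n(delta_0)] and increase to the tree sum.

    The quantitative input is
    [(sup_i xi_i Y_i)^p <= \sum_i xi_i^p Y_i^p], whose expectation is at most
    [c(p) E Y^p] when the [Y_i] are i.i.d. and independent of the [xi_i].
    Applied to [|X_i - X'_i|] it gives the contraction.  As [xi_i < 1],
    [c(q) -> 0] when [q -> oo]; for [q] large the inequality
    [(a + b)^q <= A a^q + B b^q], with [B] so close to [1] that [B c(q) < 1],
    bounds the [q]-th moments of the truncated sums uniformly.

    Endogeny: in an invariant RTP, iterating the recursion gives [X >= tree sum]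
    a.s., and the two variables have the same integrable law, so they are
    equal a.s. *)
Require Import Defs.
From HB Require Import structures.
From mathcomp Require Import all_boot all_order all_algebra.
From mathcomp Require Import finmap.
From mathcomp Require Import all_classical all_reals all_analysis.
From mathcomp Require Import measurable_realfun.
Import Order.TTheory GRing.Theory Num.Theory.
Import numFieldNormedType.Exports.
Set Implicit Arguments.
Unset Strict Implicit.
Unset Printing Implicit Defensive.
Local Open Scope classical_set_scope.
Local Open Scope ring_scope.

(** * Infinite products of probability spaces *)

Section InfiniteProduct.
Context {R : realType} {d : measure_display} {T : measurableType d}
  (P : probability T R).
Local Open Scope ereal_scope.

(** [Trel] speaks of every probability space that carries the input. Establishing it takes two
    things: some space on which the input exists, and a proof that the outcome has the same law on
    all of them. The first calls for a countable product of copies of an arbitrary space [O0], where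
    no topology is given and compactness cannot yield countable additivity; integration over one
    coordinate at a time does. The second comes from writing all the data as one sequence of
    extended reals, so that equality of laws is checked on cylinders.

    Finiteness of the tree sum is known only after the moment bound. The functionals therefore take
    values in [\bar R] and pass to real laws through [fine], off a null set.

    [mu] is at hand before the contraction is used. Uniqueness and convergence are both read off
    from [dW p nu' mu <= k * dW p nu mu] for [Trel nu nu'], together with finiteness of the distance
    on [Fp] and the fact that distance 0 forces equality of laws. *)

Definition rect (B : (nat -> set T) * nat) : set (nat -> T) :=
  [set x | forall i, B.1 i (x i)].

(** The bound [B.2] belongs to the code of a cylinder so that its mass is a finite product. One set
    has many codes; [rect_massE] shows that the mass does not depend on the choice. *)
Definition good_rect (B : (nat -> set T) * nat) : Prop :=
  (forall i, measurable (B.1 i)) /\ (forall i, (B.2 <= i)%N -> B.1 i = setT).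

Definition rects : set (set (nat -> T)) := [set rect B | B in good_rect].

(** An explicit code of the empty cylinder; it pads finite families of cylinders to sequences. *)
Definition void_rect : (nat -> set T) * nat :=
  (fun i => if i == 0%N then set0 else setT, 1%N).

Lemma good_void_rect : good_rect void_rect.
Proof.
by split=> [i|i]; rewrite /void_rect/=; [case: ifP|case: i].
Qed.

Lemma rect_void : rect void_rect = set0.
Proof. by rewrite -subset0 => x /(_ 0%N). Qed.

Definition tail_mass (B : (nat -> set T) * nat) (n : nat) : \bar R :=
  \prod_(n <= i < B.2) P (B.1 i).

(** The conditional mass of [rect B] given the first [n] coordinates of [x]. It is the total mass at
    [n = 0] and the indicator of [rect B] from [n = B.2] on. *)
Definition prefix_mass (B : (nat -> set T) * nat) (n : nat) (x : nat -> T) :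
  \bar R := (\prod_(i < n) \1_(B.1 i) (x i))%R%:E * tail_mass B n.

Lemma tail_mass_ge0 B n : 0 <= tail_mass B n.
Proof. by rewrite /tail_mass; apply: prode_ge0. Qed.

Lemma tail_massS B n : good_rect B ->
  tail_mass B n = P (B.1 n) * tail_mass B n.+1.
Proof.
move=> [_ BT]; rewrite /tail_mass; have [nB|Bn] := ltnP n B.2.
  by rewrite big_ltn.
by rewrite !big_geq ?(leqW Bn)// BT// probability_setT mule1.
Qed.

Lemma prefix_mass_ge0 B n x : 0 <= prefix_mass B n x.
Proof.
by rewrite mule_ge0 ?tail_mass_ge0// lee_fin; apply: prodr_ge0.
Qed.

Definition upd (x : nat -> T) (n : nat) (t : T) (i : nat) : T :=
  if i == n then t else x i.

Lemma prefix_mass_ext B n x y : (forall i, (i < n)%N -> x i = y i) ->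
  prefix_mass B n x = prefix_mass B n y.
Proof.
move=> xy; rewrite /prefix_mass; congr (_%:E * _).
by apply: eq_bigr => i _; rewrite xy.
Qed.

Lemma prefix_mass_upd B n x t : prefix_mass B n.+1 (upd x n t) =
  (\prod_(i < n) \1_(B.1 i) (x i))%R%:E * tail_mass B n.+1 * (\1_(B.1 n) t)%:E.
Proof.
rewrite /prefix_mass big_ord_recr/= {2}/upd eqxx EFinM -!muleA.
congr (_ * _); last by rewrite muleC.
congr (_%:E); apply: eq_bigr => i _.
by rewrite /upd ltn_eqF.
Qed.

Lemma measurable_prefix_mass_upd B n x : good_rect B ->
  measurable_fun setT (fun t => prefix_mass B n.+1 (upd x n t)).
Proof.
move=> [mB _]; under eq_fun do rewrite prefix_mass_upd.
apply: measurable_funeM; apply/measurable_EFinP.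
exact: measurable_indic.
Qed.

(** The martingale property of the conditional masses. *)
Lemma integral_prefix_mass B n x : good_rect B ->
  \int[P]_t prefix_mass B n.+1 (upd x n t) = prefix_mass B n x.
Proof.
move=> gB; under eq_integral do rewrite prefix_mass_upd.
rewrite ge0_integralZl//; last 2 first.
- by apply/measurable_EFinP; apply: measurable_indic; exact: gB.1.
- by rewrite mule_ge0 ?tail_mass_ge0// lee_fin; apply: prodr_ge0.
rewrite integral_indic ?setIT//; last exact: gB.1.
by rewrite /prefix_mass (tail_massS n gB) -!muleA; congr (_ * _); rewrite muleC.
Qed.

(* Saeki's argument: a strict inequality between total masses is propagated
   coordinate by coordinate to a single point, where it becomes an inequality
   between indicators. *)
Lemma rect_series_lt_point (U V : nat -> (nat -> set T) * nat) :
  (forall k, good_rect (U k)) -> (forall k, good_rect (V k)) ->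
  \sum_(k <oo) tail_mass (U k) 0 < \sum_(k <oo) tail_mass (V k) 0 ->
  exists x, forall n,
    \sum_(k <oo) prefix_mass (U k) n x < \sum_(k <oo) prefix_mass (V k) n x.
Proof.
move=> gU gV UV.
pose lt n x := \sum_(k <oo) prefix_mass (U k) n x <
  \sum_(k <oo) prefix_mass (V k) n x.
have step n x : lt n x -> exists t, lt n.+1 (upd x n t).
  (* If the inequality failed at level [n.+1] for every [t], integrating over [t] would make it fail
     at level [n]. *)
  move=> ltn; apply: contrapT => /forallNP nlt.
  move: ltn; rewrite /lt; apply/negP; rewrite -leNgt.
  have E W : (forall k, good_rect (W k)) -> \sum_(k <oo) prefix_mass (W k) n x =
      \int[P]_t \sum_(k <oo) prefix_mass (W k) n.+1 (upd x n t).
    move=> gW; rewrite integral_nneseries//.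
    - by apply: eq_eseriesr => k _; rewrite integral_prefix_mass.
    - by move=> k; exact: measurable_prefix_mass_upd.
    - by move=> k t _; exact: prefix_mass_ge0.
  rewrite (E U gU) (E V gV); apply: ge0_le_integral => //.
  - by move=> t _; apply: nneseries_ge0 => *; exact: prefix_mass_ge0.
  - apply: ge0_emeasurable_sum => [k t _ _|k _].
      exact: prefix_mass_ge0.
    exact: measurable_prefix_mass_upd.
  - apply: ge0_emeasurable_sum => [k t _ _|k _].
      exact: prefix_mass_ge0.
    exact: measurable_prefix_mass_upd.
  - by move=> t _; rewrite leNgt; apply/negP; exact: nlt.
have /choice[f fP] : forall nx : nat * (nat -> T), exists t,
    lt nx.1 nx.2 -> lt nx.1.+1 (upd nx.2 nx.1 t).
  move=> [n x]; have [/step[t tP]|] := pselect (lt n x); first by exists t.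
  by exists point.
pose y := fix y n := if n is m.+1 then upd (y m) m (f (m, y m)) else point.
have lty n : lt n (y n).
  elim: n => [|n IH]; last exact: (fP (n, y n)).
  rewrite /lt; under eq_eseriesr do rewrite /prefix_mass big_ord0 mul1e.
  by under [ltRHS]eq_eseriesr do rewrite /prefix_mass big_ord0 mul1e.
have yE n m i : (i < n)%N -> y (n + m)%N i = y n i.
  move=> ltin; elim: m => [|m IH]; first by rewrite addn0.
  rewrite addnS/= -[RHS]IH /upd ifN// neq_ltn.
  by rewrite (leq_trans ltin)// leq_addr.
(* Coordinate [i] no longer changes after stage [i.+1], so the diagonal agrees with [y n] below
   [n]. *)
exists (fun i => y i.+1 i) => n; have := lty n; rewrite /lt.
have E i : (i < n)%N -> y n i = y i.+1 i.
  by move=> ltin; rewrite -(subnKC ltin) yE.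
under eq_eseriesr do rewrite (prefix_mass_ext _ E).
by under [ltRHS]eq_eseriesr do rewrite (prefix_mass_ext _ E).
Qed.

Lemma prefix_mass_rect B n x : (B.2 <= n)%N -> good_rect B ->
  prefix_mass B n x = (\1_(rect B) x)%:E.
Proof.
move=> Bn [_ BT]; rewrite /prefix_mass /tail_mass big_geq// mule1.
rewrite indicE; have [xB|xB] := boolP (x \in rect B).
  move: xB; rewrite inE => xB; congr (_%:E); apply: big1 => i _.
  by rewrite indicE mem_set//; exact: xB.
have [i ltin xi] : exists2 i, (i < n)%N & ~ B.1 i (x i).
  apply: contrapT => h; move: xB; rewrite notin_setE; apply => i.
  have [ni|ltin] := leqP n i.
    by rewrite BT// (leq_trans Bn).
  by apply: contrapT => xi; apply: h; exists i.
rewrite (bigD1 (Ordinal ltin))//= indicE memNset// mul0r//.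
Qed.

Lemma prefix_mass_void n x : prefix_mass void_rect n x = 0.
Proof.
case: n => [|n]; last by rewrite prefix_mass_rect ?rect_void ?indic0//;
    exact: good_void_rect.
by rewrite /prefix_mass /tail_mass/= big_nat1/= measure0 mule0.
Qed.

Lemma tail_massE B : tail_mass B 0 = prefix_mass B 0 point.
Proof. by rewrite /prefix_mass big_ord0 mul1e. Qed.

(** Each inequality is refuted at the point supplied by [rect_series_lt_point]. If a partial sum
    exceeds the mass of [V], only finitely many cylinders are involved, and at one common level all
    masses are indicators of disjoint subsets of [rect V]. If the series falls short, the one member
    that contains the point already contributes 1. *)
Lemma rect_sigma_additive (W : nat -> (nat -> set T) * nat) V :
  (forall k, good_rect (W k)) -> good_rect V ->
  trivIset setT (fun k => rect (W k)) -> \bigcup_k rect (W k) = rect V ->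
  \sum_(k <oo) tail_mass (W k) 0 = tail_mass V 0.
Proof.
move=> gW gV tW WV.
pose V' k := if k == 0%N then V else void_rect.
have gV' k : good_rect (V' k).
  by rewrite /V'; case: ifP => // _; exact: good_void_rect.
have V'E n x : \sum_(k <oo) prefix_mass (V' k) n x = prefix_mass V n x.
  rewrite (nneseries_split 0 1); last by move=> *; exact: prefix_mass_ge0.
  rewrite big_nat1 eseries0 ?adde0// => k k0 _.
  by rewrite /V' ifN ?prefix_mass_void//; case: k k0.
have W0 k n x : 0 <= prefix_mass (W k) n x by exact: prefix_mass_ge0.
apply/eqP; rewrite eq_le; apply/andP; split.
  apply: lime_le.
    by apply: is_cvg_nneseries => *; exact: tail_mass_ge0.
  apply: nearW => K; rewrite leNgt; apply/negP => VW.
  pose W' k := if (k < K)%N then W k else void_rect.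
  have gW' k : good_rect (W' k).
    by rewrite /W'; case: ifP => // _; exact: good_void_rect.
  have W'E n x : \sum_(k <oo) prefix_mass (W' k) n x =
      \sum_(0 <= k < K) prefix_mass (W k) n x.
    rewrite (nneseries_split 0 K); last by move=> *; exact: prefix_mass_ge0.
    rewrite add0n eseries0 ?adde0//.
      by apply: eq_big_nat => k /andP[_ kK]; rewrite /W' kK.
    by move=> k k0 _; rewrite /W' ltnNge k0/= prefix_mass_void.
  have [|x xP] := rect_series_lt_point gV' gW'.
    under eq_eseriesr do rewrite tail_massE.
    under [ltRHS]eq_eseriesr do rewrite tail_massE.
    rewrite V'E W'E -tail_massE.
    by under eq_bigr do rewrite -tail_massE.
  (* This level is at least the bounds of [V] and of the first [K] members, so every conditional
     mass has become an indicator. *)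
  pose n := (V.2 + \sum_(0 <= k < K) (W k).2)%N.
  have := xP n; rewrite V'E W'E prefix_mass_rect ?leq_addr//.
  under eq_big_nat => k /andP[_ kK].
    rewrite prefix_mass_rect//; last first.
      rewrite /n big_mkord (bigD1 (Ordinal kK))//= addnCA leq_addr//.
    over.
  have [[k [kK xk]]|nk] := pselect (exists k, (k < K)%N /\ rect (W k) x).
    rewrite big_mkord (bigD1 (Ordinal kK))//= big1 ?adde0.
      rewrite !indicE !mem_set// ?ltxx//.
      by rewrite -WV; exists k.
    move=> j jk; rewrite indicE memNset// => xj.
    move: jk => /eqP; apply; apply/val_inj => /=.
    by apply: (tW j k) => //; exists x.
  rewrite big_nat_cond big1; first by rewrite ltNge lee_fin indicE ler0n.
  move=> k /andP[/andP[_ kK] _]; rewrite indicE memNset// => xk.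
  by apply: nk; exists k.
rewrite leNgt; apply/negP => VW.
have [|x xP] := rect_series_lt_point gW gV'.
  under [ltRHS]eq_eseriesr do rewrite tail_massE.
  by rewrite V'E -tail_massE.
have [xV|xV] := pselect (rect V x); last first.
  have := xP V.2; rewrite V'E prefix_mass_rect// indicE memNset//.
  by rewrite ltNge nneseries_ge0.
have := xV; rewrite -WV => -[k _ xk].
have := xP (V.2 + (W k).2)%N; rewrite V'E prefix_mass_rect ?leq_addr//.
(* The side of [V] equals 1 here, and term [k] of the series reaches it alone. *)
rewrite indicE mem_set// ltNge; apply/negP; rewrite negbK.
apply: le_trans (nneseries_lim_ge k.+1 _) => //.
rewrite big_mkord (bigD1 ord_max)//= [X in X + _]prefix_mass_rect ?leq_addl//.
by rewrite indicE mem_set// leeDl// sume_ge0.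
Qed.

End InfiniteProduct.

Section RectSemiRing.
Context {d : measure_display} {T : measurableType d}.

Lemma rects0 : @rects d T set0.
Proof. by exists void_rect; [exact: good_void_rect|exact: rect_void]. Qed.

Lemma rectsT : @rects d T setT.
Proof.
exists (fun=> setT, 0%N); last by apply/seteqP; split.
by split=> i //= _; exact: measurableT.
Qed.

Lemma rectI (B C : (nat -> set T) * nat) :
  rect B `&` rect C = rect (fun i => B.1 i `&` C.1 i, maxn B.2 C.2).
Proof.
apply/seteqP; split=> [x [xB xC] i|x xBC]; first by split.
by split=> i; have [] := xBC i.
Qed.

Lemma rectsI : setI_closed (@rects d T).
Proof.
move=> _ _ [B gB <-] [C gC <-]; rewrite rectI.
exists (fun i => B.1 i `&` C.1 i, maxn B.2 C.2) => //; split=> [i|i] /=.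
  by apply: measurableI; [exact: gB.1|exact: gC.1].
by rewrite geq_max => /andP[iB iC]; rewrite gB.2// gC.2// setIT.
Qed.

(* B \ C splits according to the first coordinate that leaves C. *)
Lemma rectsD : semi_setD_closed (@rects d T).
Proof.
move=> _ _ [B gB <-] [C gC <-].
pose D n := rect (fun i => if (i < n)%N then B.1 i `&` C.1 i
  else if i == n then B.1 i `\` C.1 i else B.1 i, maxn n.+1 B.2).
exists [set D n | n in `I_C.2]; split.
- exact: finite_image.
- move=> _ [n _ <-]; eexists; last by [].
  split=> [i|i] /=.
    have mB := gB.1 i; have mC := gC.1 i.
    by do 2?case: ifP => _ //; [exact: measurableI|exact: measurableD].
  rewrite geq_max => /andP[ni Bi].
  by rewrite ltnNge (ltnW ni)/= gtn_eqF//= gB.2.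
- rewrite bigcup_image; apply/seteqP; split=> [x [xB xC]|x [n _ xD]].
    have exn : exists n, `[< ~ C.1 n (x n) >].
      apply: contrapT => h; apply: xC => i; apply: contrapT => xi.
      by apply: h; exists i; apply/asboolP.
    case: (ex_minnP exn) => n /asboolP xn minn.
    exists n => /=.
      rewrite ltnNge; apply/negP => Cn; apply: xn.
      by rewrite gC.2.
    move=> i /=; case: ifP => [lin|_].
      split; first exact: xB.
      apply: contrapT => xi; have := minn i (asboolT xi).
      by rewrite leqNgt lin.
    by case: eqP => [->|_]; [split => //; exact: xB|exact: xB].
  split.
    move=> i; have := xD i => /=; case: ifP => _; first by case.
    by case: ifP => _ //; case.
  by move=> xC; have := xD n => /=; rewrite ltnn eqxx => -[_]; apply.
- move=> _ _ [n _ <-] [m _ <-] [x [xn xm]].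
  suff -> : n = m by [].
  wlog nm : n m xn xm / (n < m)%N.
    by move=> h; case: (ltngtP n m) => // nm; [exact: h|apply/esym; exact: h].
  by have := xm n; have := xn n => /=; rewrite nm ltnn eqxx => -[_ ?] [].
Qed.

End RectSemiRing.

(** A copy of [nat -> T] on which the semiring of cylinders is declared; [sequences_over] carries
    the sigma-algebra generated by it. *)
Definition seq_of (T : Type) : Type := nat -> T.

Fact rect_display (d : measure_display) : measure_display. Proof. exact: d. Qed.

HB.instance Definition _ (d : measure_display) (T : measurableType d) :=
  Pointed.on (seq_of T).
HB.instance Definition _ (d : measure_display) (T : measurableType d) :=
  @isSemiRingOfSets.Build (rect_display d) (seq_of T) (@rects d T)
    rects0 rectsI rectsD.

Definition sequences_over (d : measure_display) (T : measurableType d) :=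
  g_sigma_algebraType (@measurable (rect_display d) (seq_of T)).
HB.instance Definition _ (d : measure_display) (T : measurableType d) :=
  Measurable.on (sequences_over T).

Section InfiniteProductMeasure.
Context {R : realType} {d : measure_display} {T : measurableType d}
  (P : probability T R).
Local Open Scope ereal_scope.

Definition rect_mass (A : set (seq_of T)) : \bar R :=
  tail_mass P (xget (fun=> set0, 0%N) [set B | good_rect B /\ rect B = A]) 0.

(** Two codes of one set have equal masses: this is sigma-additivity for the partition of [rect C]
    into the single piece [rect B], padded by empty cylinders. *)
Lemma rect_massE B : good_rect B -> rect_mass (rect B) = tail_mass P B 0.
Proof.
move=> gB; rewrite /rect_mass; case: xgetP => [C _ [gC CB]|]; last first.
  by move=> /(_ B); case.
pose W (D : (nat -> set T) * nat) k := if k == 0%N then D else void_rect.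
have gV := @good_void_rect d T.
have WE D : \sum_(k <oo) tail_mass P (W D k) 0 = tail_mass P D 0.
  rewrite (nneseries_split 0 1); last by move=> *; exact: tail_mass_ge0.
  rewrite big_nat1 eseries0 ?adde0// => k k0 _; rewrite /W gtn_eqF//.
  by rewrite /tail_mass big_nat1/= measure0.
have := @rect_sigma_additive R d T P (W B) C; rewrite WE => -> //.
- by move=> k; rewrite /W; case: ifP.
- apply/trivIsetP => -[|i] [|j] _ _ //= _; rewrite /W/= rect_void ?set0I ?setI0//.
- rewrite CB; apply/seteqP; split=> [x [[|k] _]|x xB]; rewrite /W/= ?rect_void//.
  by exists 0%N.
Qed.

Let rect_mass0 : rect_mass set0 = 0.
Proof.
rewrite -(@rect_void d T) rect_massE; last exact: good_void_rect.
by rewrite /tail_mass big_nat1/= measure0.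
Qed.

Let rect_mass_ge0 A : 0 <= rect_mass A.
Proof. exact: tail_mass_ge0. Qed.

Let rect_mass_sigma_additive : semi_sigma_additive rect_mass.
Proof.
move=> F mF tF mUF.
have [V gV VE] := mUF.
have /choice[W WE] : forall k, exists B, good_rect B /\ rect B = F k.
  by move=> k; have [B gB BE] := mF k; exists B.
have -> : rect_mass (\bigcup_n F n) = \sum_(k <oo) rect_mass (F k).
  rewrite -VE rect_massE//.
  rewrite -(@rect_sigma_additive R d T P W V)//.
  - apply: eq_eseriesr => k _; have [gW <-] := WE k.
    by rewrite rect_massE.
  - by move=> k; have [] := WE k.
  - rewrite (_ : (fun k => rect (W k)) = F)//.
    by apply/funext => k; have [] := WE k.
  - by rewrite VE; apply: eq_bigcupr => k _; have [] := WE k.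
by apply: is_cvg_nneseries => n _ _; exact: rect_mass_ge0.
Qed.

HB.instance Definition _ := isMeasure.Build (rect_display d) (seq_of T) R
  rect_mass rect_mass0 rect_mass_ge0 rect_mass_sigma_additive.

Definition infprod : set (sequences_over T) -> \bar R :=
  measure_extension (rect_mass : {measure set (seq_of T) -> \bar R}).
HB.instance Definition _ := Measure.on infprod.

Lemma infprod_rect (B : (nat -> set T) * nat) : good_rect B ->
  infprod (rect B) = \prod_(0 <= i < B.2) P (B.1 i).
Proof.
move=> gB; rewrite /infprod /measure_extension measurable_mu_extE/=.
  by rewrite rect_massE.
by exists B.
Qed.

Lemma infprodT : infprod setT = 1.
Proof.
have [B gB BT] := @rectsT d T.
have -> : setT = rect (fun=> [set: T], 0%N) by apply/seteqP; split.
by rewrite infprod_rect ?big_geq//; split=> i //= _; exact: measurableT.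
Qed.

HB.instance Definition _ := Measure_isProbability.Build _ _ _ infprod infprodT.

End InfiniteProductMeasure.

Lemma measurable_coord d (T : measurableType d) (i : nat) :
  measurable_fun setT (fun x : sequences_over T => x i).
Proof.
move=> _ A mA; rewrite setTI; apply: sub_sigma_algebra.
exists (fun j => if j == i then A else setT, i.+1).
  by split=> [j|j] /=; [case: ifP|move=> ij; rewrite gtn_eqF].
apply/seteqP; split=> [x /(_ i)/=|x xA j /=]; first by rewrite eqxx.
by case: eqP => [->|].
Qed.

(** * Laws determined by independent blocks *)

Section LawUniqueness.
Context {R : realType}.
Local Open Scope ereal_scope.

(* A countable family is stored as one sequence along [pickle]; numbers that are
   not codes carry the junk value 0. *)
Definition encode {I : countType} {Om : Type} (Z : I -> nat -> Om -> \bar R)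
    (w : Om) : sequences_over (\bar R) :=
  fun k => if @pickle_inv (I * nat)%type k is Some p then Z p.1 p.2 w else 0.

Lemma measurable_to_sequences {d d'} {Om : measurableType d'}
    {T : measurableType d} (D : Om -> sequences_over T) :
  (forall k, measurable_fun setT (fun w => D w k)) -> measurable_fun setT D.
Proof.
move=> mD; apply: (@measurability _ _ _ _ setT D (@rects d T)) => //.
move=> _ [_ [B gB <-] <-]; rewrite setTI.
have -> : D @^-1` rect B = \bigcap_k ((fun w => D w k) @^-1` B.1 k).
  by apply/seteqP; split=> [w Dw k _|w Dw k]; [exact: Dw|exact: (Dw k I)].
apply: bigcapT_measurable => k; rewrite -[X in measurable X]setTI.
by apply: mD => //; exact: gB.1.
Qed.

Lemma measurable_encode {d} {I : countType} {Om : measurableType d}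
    (Z : I -> nat -> Om -> \bar R) :
  (forall i j, measurable_fun setT (Z i j)) -> measurable_fun setT (encode Z).
Proof.
move=> mZ; apply: measurable_to_sequences => k; rewrite /encode.
by case: pickle_inv => [p|]; [exact: mZ|exact: measurable_cst].
Qed.

Lemma probability_law {d d'} {Om : measurableType d} {T : measurableType d'}
    (P : probability Om R) (f : Om -> T) : measurable_fun setT f ->
  exists nu : probability T R, forall A, nu A = P (f @^-1` A).
Proof.
move=> mf.
pose g : {mfun Om >-> T} := mfun_Sub (mem_set mf).
by exists (distribution P g).
Qed.

(** Cylinders generate the sigma-algebra of sequences and are stable under intersection. A cylinder
    constrains finitely many blocks [Z i], and independence of the blocks turns its probability into
    a product of block probabilities, which agree. *)
Lemma encode_law_unique {I : countType} {d1 d2} {O1 : measurableType d1}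
    {O2 : measurableType d2} (P1 : probability O1 R) (P2 : probability O2 R)
    (Z1 : I -> nat -> O1 -> \bar R) (Z2 : I -> nat -> O2 -> \bar R) F1 F2 :
  (forall i j, measurable_fun setT (Z1 i j)) ->
  (forall i j, measurable_fun setT (Z2 i j)) ->
  indep_family P1 F1 -> indep_family P2 F2 ->
  (forall i (B : nat -> set (\bar R)) n, (forall j, measurable (B j)) ->
    (forall j, (n <= j)%N -> B j = setT) ->
    [/\ F1 i [set w | forall j, B j (Z1 i j w)],
        F2 i [set w | forall j, B j (Z2 i j w)] &
        P1 [set w | forall j, B j (Z1 i j w)] =
        P2 [set w | forall j, B j (Z2 i j w)]]) ->
  forall C, measurable C -> P1 (encode Z1 @^-1` C) = P2 (encode Z2 @^-1` C).
Proof.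
move=> mZ1 mZ2 indep1 indep2 blocks.
have [m1 m1E] := probability_law P1 (measurable_encode mZ1).
have [m2 m2E] := probability_law P2 (measurable_encode mZ2).
move=> C mC; rewrite -m1E -m2E; move: C mC.
refine (@measure_unique _ R (sequences_over (\bar R)) (@rects _ (\bar R)) (fun=> setT) _ _ _ _ m1 m2 _ _) => //.
- exact: rectsI.
- by move=> _; exact: rectsT.
- by apply/seteqP; split=> // x _; exists 0%N.
- move=> _ [B gB <-]; apply: etrans (m1E _) _; apply: etrans (esym (m2E _)).
  (* A number that codes no index always reads 0. If the cylinder excludes 0 at such a position,
     both preimages are empty. *)
  have [None0|/existsNP[k /not_implyP[kN Bk]]] := pselect (forall k,
      @pickle_inv (I * nat)%type k = None -> B.1 k 0); last first.
    have E d (O : measurableType d) (Z : I -> nat -> O -> \bar R) :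
        encode Z @^-1` rect B = set0.
      by rewrite -subset0 => w /(_ k); rewrite /encode kN.
    by rewrite !E !measure0.
  (* [J] will hold the blocks met by the constrained positions, and [n] will exceed every inner
     index that occurs there; outside these the sides are full. *)
  pose L : seq (I * nat) := pmap (@pickle_inv (I * nat)%type) (iota 0 B.2).
  pose J : {fset I} := [fset p.1 | p in L]%fset.
  pose n := (\sum_(p <- L) p.2.+1)%N.
  have BT i j : (i \notin J) || (n <= j)%N -> B.1 (choice.pickle (i, j)) = setT.
    move=> ijN; apply: gB.2; rewrite leqNgt; apply/negP => ltB.
    have ijL : (i, j) \in L.
      rewrite mem_pmap; apply/mapP; exists (choice.pickle (i, j)).
        by rewrite mem_iota.
      by rewrite pickleK_inv.
    case/orP: ijN => [/negP|]; first by apply; apply/imfsetP; exists (i, j).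
    rewrite leqNgt => /negP; apply; rewrite /n (big_rem _ ijL)/=.
    by rewrite leq_addr.
  pose A d (O : measurableType d) (Z : I -> nat -> O -> \bar R) i :=
    [set w | forall j, B.1 (choice.pickle (i, j)) (Z i j w)].
  have E d (O : measurableType d) (Z : I -> nat -> O -> \bar R) :
      encode Z @^-1` rect B = \bigcap_(i in [set` J]) A d O Z i.
    apply/seteqP; split=> [w wB i _ j|w wA k].
      by have := wB (choice.pickle (i, j)); rewrite /encode pickleK_inv.
    rewrite /encode; case kE : pickle_inv => [[i j]|]; last exact: None0.
    have [iJ|iJ] := boolP (i \in J).
      have := wA i iJ j; suff -> : choice.pickle (i, j) = k by [].
      by have := choice.pickle_invK (T := (I * nat)%type) k; rewrite kE.
    have <- : choice.pickle (i, j) = k.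
      by have := choice.pickle_invK (T := (I * nat)%type) k; rewrite kE.
    by rewrite BT// iJ.
  have bl i := blocks i (fun j => B.1 (choice.pickle (i, j))) n
    (fun j => gB.1 _) (fun j nj => BT i j (introT orP (or_intror nj))).
  rewrite !E indep1 ?indep2//.
  - by apply: eq_bigr => i _; have [] := bl i.
  - by move=> i _; have [] := bl i.
  - by move=> i _; have [] := bl i.
- have m1T : m1 setT < +oo by rewrite probability_setT ltry.
  by move=> k; exact: m1T.
Qed.

End LawUniqueness.

(** * The recursion map and the tree functionals *)

Section Measurability.
Context {R : realType} {d : measure_display} {Om : measurableType d}.
Local Open Scope ereal_scope.

(** A supremum over a random index set is a supremum over all codes, with the value [-oo] at the
    excluded indices. *)
Lemma measurable_ereal_sup_countable {I : countType} (f : I -> Om -> \bar R)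
    (S : I -> set Om) :
  (forall i, measurable_fun setT (f i)) -> (forall i, measurable (S i)) ->
  measurable_fun setT (fun w => ereal_sup [set f i w | i in [set i | S i w]]).
Proof.
move=> mf mS.
pose g k w : \bar R := if @pickle_inv I k is Some i then
  (if w \in S i then f i w else -oo) else -oo.
have -> : (fun w => ereal_sup [set f i w | i in [set i | S i w]]) =
    fun w => esups (g^~ w) 0%N.
  apply/funext => w; apply/eqP; rewrite eq_le; apply/andP; split.
    apply: ge_ereal_sup => _ [i Siw <-]; apply: ereal_sup_ubound.
    exists (choice.pickle i) => //; rewrite /g pickleK_inv mem_set//.
  apply: ge_ereal_sup => _ [k _ <-]; rewrite /g.
  case: pickle_inv => [i|]; last exact: leNye.
  case: ifPn => [Siw|_]; last exact: leNye.
  by apply: ereal_sup_ubound; exists i => //; exact: set_mem.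
apply: measurable_fun_esups => k; rewrite /g.
case: pickle_inv => [i|]; last exact: measurable_cst.
apply: measurable_fun_ifT => //; apply: (measurable_fun_bool true).
rewrite setTI; suff -> : (fun w => w \in S i) @^-1` [set true] = S i by [].
by apply/seteqP; split=> w /=; [exact: set_mem|exact: mem_set].
Qed.

Lemma measurable_le_star i (N : Om -> \bar R) : measurable_fun setT N ->
  measurable [set w | le_star i (N w)].
Proof.
move=> mN; rewrite -[X in measurable X]setTI.
exact: measurable_lee.
Qed.

Lemma measurable_sup_nn (f : nat -> Om -> \bar R) (N : Om -> \bar R) :
  (forall i, measurable_fun setT (f i)) -> measurable_fun setT N ->
  measurable_fun setT
    (fun w => sup_nn [set f i w | i in [set i | le_star i (N w)]]).
Proof.
move=> mf mN.
pose g (o : option nat) w := if o is Some i then f i w else 0.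
pose S (o : option nat) := if o is Some i then [set w | le_star i (N w)] else setT.
have -> : (fun w => sup_nn [set f i w | i in [set i | le_star i (N w)]]) =
    fun w => ereal_sup [set g o w | o in [set o | S o w]].
  apply/funext => w; congr ereal_sup; apply/seteqP; split.
    by move=> _ [->|[i iN <-]]; [exists None|exists (Some i)].
  by move=> _ [[i|] iN <-]; [right; exists i|left].
apply: measurable_ereal_sup_countable => -[i|] /=.
- exact: mf.
- exact: measurable_cst.
- exact: measurable_le_star.
- exact: measurableT.
Qed.

End Measurability.

Section RecursionMap.
Context {R : realType}.
Local Open Scope ereal_scope.

(** Extended values at the children allow iteration before finiteness is known. *)
Definition step (e : R) (x : nat -> R) (n : \bar R) (y : nat -> \bar R) : \bar R :=
  e%:E + sup_nn [set (x i)%:E * y i | i in [set i | le_star i n]].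

(* For nonnegative data: the supremum over paths from [v] with at most [n] vertices. *)
Fixpoint depth_sum (n : nat) (e : seq nat -> R) (x : seq nat -> nat -> R)
    (m : seq nat -> \bar R) (v : seq nat) : \bar R :=
  if n is n'.+1 then
    step (e v) (x v) (m v) (fun j => depth_sum n' e x m (rcons v j))
  else 0.

(** [tree_sum] over the one-point space, that is, the deterministic functional of the tree data
    behind it. *)
Definition path_sup (e : seq nat -> R) (x : seq nat -> nat -> R)
    (m : seq nat -> \bar R) : \bar R :=
  @tree_sum R _ unit (fun v _ => e v) (fun v j _ => x v j) (fun v _ => m v) tt.

Lemma tree_sumE d (Om : measurableType d) etaT xiT NT (w : Om) :
  tree_sum etaT xiT NT w = path_sup (etaT^~ w) (fun v j => xiT v j w) (NT^~ w).
Proof. by []. Qed.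

Context {d : measure_display} {Om : measurableType d}.

Lemma measurable_step (e : Om -> R) (x : nat -> Om -> R) (m : Om -> \bar R)
    (y : nat -> Om -> \bar R) : data_meas e x m ->
  (forall i, measurable_fun setT (y i)) ->
  measurable_fun setT (fun w => step (e w) (x^~ w) (m w) (y^~ w)).
Proof.
move=> [me mx mm] my; apply: emeasurable_funD; first exact/measurable_EFinP.
apply: measurable_sup_nn => // i.
by apply: emeasurable_funM => //; exact/measurable_EFinP.
Qed.

Context (etaT : seq nat -> Om -> R) (xiT : seq nat -> nat -> Om -> R)
  (NT : seq nat -> Om -> \bar R).
Hypothesis mT : forall v, data_meas (etaT v) (xiT v) (NT v).

Lemma measurable_depth_sum n v : measurable_fun setT
  (fun w => depth_sum n (etaT^~ w) (fun v j => xiT v j w) (NT^~ w) v).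
Proof.
elim: n v => [|n IH] v /=; first exact: measurable_cst.
by apply: measurable_step => //.
Qed.

Lemma measurable_path_sup : measurable_fun setT
  (fun w => path_sup (etaT^~ w) (fun v j => xiT v j w) (NT^~ w)).
Proof.
apply: (measurable_ereal_sup_countable
  (f := fun v w => (Wpath etaT xiT w v)%:E)
  (S := fun v => [set w | in_tree NT w v])) => v.
- apply/measurable_EFinP; apply: measurable_sum => k.
  apply: measurable_funM; first by case: (mT (take k v)).
  apply: measurable_prod => j _.
  by case: (mT (take j v)) => _ + _; apply.
- have -> : [set w | in_tree NT w v] = \bigcap_(k in `I_(size v))
      [set w | le_star (nth 0%N v k) (NT (take k v) w)].
    by apply/seteqP; split=> w /= h k; exact: h.
  apply: bigcap_measurableType => k _.
  by apply: measurable_le_star; case: (mT (take k v)).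
Qed.

End RecursionMap.

Lemma measurable_preimage_EFin {R : realType} (A : set (\bar R)) :
  measurable A -> measurable (EFin @^-1` A : set R).
Proof.
move=> mA; rewrite -[X in measurable X]setTI.
by have /measurable_EFinP := @measurable_id _ R setT; exact.
Qed.

Section DataCode.
Context {R : realType}.
Local Open Scope ereal_scope.

Definition data_code {Om : Type} (e : Om -> R) (x : nat -> Om -> R)
    (m : Om -> \bar R) (j : nat) (w : Om) : \bar R :=
  match j with 0%N => (e w)%:E | 1%N => m w | j'.+2 => (x j' w)%:E end.

Context {d : measure_display} {Om : measurableType d} (e : Om -> R)
  (x : nat -> Om -> R) (m : Om -> \bar R).

Lemma measurable_data_code j : data_meas e x m ->
  measurable_fun setT (data_code e x m j).
Proof.
by case=> me mx mm; case: j => [|[|j]] //=; exact/measurable_EFinP.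
Qed.

Lemma data_code_event (B : nat -> set (\bar R)) n :
  (forall j, (n <= j)%N -> B j = setT) ->
  [set w | forall j, B j (data_code e x m j w)] =
  data_event e x m n (EFin @^-1` B 0%N) (fun i => EFin @^-1` B i.+2) (B 1%N).
Proof.
move=> BT; apply/seteqP; split=> [w h|w [h0 hx h1] [|[|j]]] //=.
  by split=> [|i _|]; [exact: (h 0%N)|exact: (h i.+2)|exact: (h 1%N)].
have [nj|jn] := leqP n j; last exact: hx.
by rewrite BT// (leq_trans nj)// leqW.
Qed.

Lemma data_code_sigma (B : nat -> set (\bar R)) :
  (forall j, measurable (B j)) ->
  data_sigma e x m [set w | forall j, B j (data_code e x m j w)].
Proof.
move=> mB.
have -> : [set w | forall j, B j (data_code e x m j w)] =
    \bigcap_j [set w | B j (data_code e x m j w)].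
  by apply/seteqP; split=> [w h j _|w h j]; [exact: h|exact: (h j I)].
rewrite /data_sigma; set G := data_gens _ _ _.
have mG A : G A -> measurable (A : set (g_sigma_algebraType G)).
  exact: sub_sigma_algebra.
apply: (@bigcapT_measurable _ (g_sigma_algebraType G)) => -[|[|j]]; apply: mG.
- left; left; exists (EFin @^-1` B 0%N) => //; exact: measurable_preimage_EFin.
- right; exists (B 1%N) => //; exact: mB.
- left; right; exists j => //; exists (EFin @^-1` B j.+2) => //; exact: measurable_preimage_EFin.
Qed.

End DataCode.

(** * Comparing laws across probability spaces *)

Section Transfer.
Context {R : realType}.
Local Open Scope ereal_scope.

Definition decode {I : countType} (i : I) (j : nat)
  (c : sequences_over (\bar R)) : \bar R := c (choice.pickle (i, j)).

Lemma decode_encode {I : countType} {Om : Type} (Z : I -> nat -> Om -> \bar R)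
  i j w : decode i j (encode Z w) = Z i j w.
Proof. by rewrite /decode /encode pickleK_inv. Qed.

Lemma measurable_decode {I : countType} (i : I) j :
  measurable_fun setT (decode i j).
Proof. exact: measurable_coord. Qed.

Lemma measurable_fine_decode {I : countType} (i : I) j :
  measurable_fun setT (fun c => fine (decode i j c)).
Proof.
apply: (measurableT_comp (f := fine)); first exact: fine_measurable.
exact: measurable_decode.
Qed.

Lemma decode_data_meas {I : countType} (i : I) :
  data_meas (fun c => fine (decode i 0 c)) (fun j c => fine (decode i j.+2 c))
    (decode i 1).
Proof.
by split=> [|j|]; [exact: measurable_fine_decode|exact: measurable_fine_decode|
  exact: measurable_decode].
Qed.

Context {d0 : measure_display} {O0 : measurableType d0} (P0 : probability O0 R)
  (eta : O0 -> R) (xi : nat -> O0 -> R) (N : O0 -> \bar R).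

(** The quantification over spaces allows [Psi] to be read on the space of codes itself, with the
    decoded coordinates as data. *)
Definition measurable_functional (Psi : (seq nat -> R) ->
    (seq nat -> nat -> R) -> (seq nat -> \bar R) -> \bar R) : Prop :=
  forall d (Om : measurableType d) e x n, (forall v, data_meas (e v) (x v) (n v)) ->
  measurable_fun setT
    (fun w : Om => Psi (e^~ w) (fun v j => x v j w) (n^~ w)).

Section TreeLaw.
Context {d1 d2 : measure_display} {O1 : measurableType d1}
  {O2 : measurableType d2} (P1 : probability O1 R) (P2 : probability O2 R)
  (e1 : seq nat -> O1 -> R) (x1 : seq nat -> nat -> O1 -> R)
  (n1 : seq nat -> O1 -> \bar R) (e2 : seq nat -> O2 -> R)
  (x2 : seq nat -> nat -> O2 -> R) (n2 : seq nat -> O2 -> \bar R).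

(** Both events are preimages, under the encoded data, of one measurable set [C] of sequences; the
    vertices are the independent blocks. *)
Lemma tree_law_unique Psi : measurable_functional Psi ->
  tree_data P0 eta xi N P1 e1 x1 n1 -> tree_data P0 eta xi N P2 e2 x2 n2 ->
  forall B, measurable B ->
  P1 [set w | B (Psi (e1^~ w) (fun v j => x1 v j w) (n1^~ w))] =
  P2 [set w | B (Psi (e2^~ w) (fun v j => x2 v j w) (n2^~ w))].
Proof.
move=> mPsi [m1 l1 i1] [m2 l2 i2] B mB.
pose Z d (O : measurableType d) (e : seq nat -> O -> R) x n v :=
  data_code (e v) (x v) (n v).
pose C : set (sequences_over (\bar R)) :=
  [set c | B (Psi (fun v => fine (decode v 0 c))
                  (fun v j => fine (decode v j.+2 c))
                  (fun v => decode v 1 c))].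
have mC : measurable C.
  rewrite -[X in measurable X]setTI.
  have := mPsi _ (sequences_over (\bar R)) (fun v c => fine (decode v 0 c))
    (fun v j c => fine (decode v j.+2 c)) (fun v c => decode v 1 c)
    (fun v => decode_data_meas v).
  by apply.
have E d (O : measurableType d) (e : seq nat -> O -> R) x n :
    [set w | B (Psi (e^~ w) (fun v j => x v j w) (n^~ w))] =
    encode (Z d O e x n) @^-1` C.
  rewrite /preimage/=; apply/funext => w /=; congr (B (Psi _ _ _)).
  - by apply/funext => v; rewrite decode_encode.
  - by apply/funext => v; apply/funext => j; rewrite decode_encode.
  - by apply/funext => v; rewrite decode_encode.
rewrite !E; apply: (encode_law_unique _ _ i1 i2) => //.
- by move=> v j; exact: measurable_data_code.
- by move=> v j; exact: measurable_data_code.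
move=> v D n mD DT; split.
- exact: data_code_sigma.
- exact: data_code_sigma.
have mE j := measurable_preimage_EFin (mD j).
by rewrite !(data_code_event _ _ _ DT) -l1// -l2.
Qed.

End TreeLaw.

Definition RDE_input (mu : probability R R) {d} {Om : measurableType d}
    (P : probability Om R) eta1 xi1 N1 (X : nat -> Om -> R) : Prop :=
  [/\ data_meas eta1 xi1 N1, (forall i, measurable_fun setT (X i)),
    same_data_law P0 eta xi N P eta1 xi1 N1,
    (forall i, law_is P (X i) mu) &
    indep_family P (fun o : option nat =>
      if o is Some i then sigmaR (X i) else data_sigma eta1 xi1 N1)].

Lemma RDE_law_unique (mu1 mu2 : probability R R)
    {d1 d2} {O1 : measurableType d1} {O2 : measurableType d2}
    (P1 : probability O1 R) (P2 : probability O2 R) e1 x1 n1 X1 e2 x2 n2 X2 :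
  (forall A, measurable A -> mu1 A = mu2 A) ->
  RDE_input mu1 P1 e1 x1 n1 X1 -> RDE_input mu2 P2 e2 x2 n2 X2 ->
  forall B, measurable B ->
  P1 [set w | B (step (e1 w) (x1^~ w) (n1 w) (fun i => (X1 i w)%:E))] =
  P2 [set w | B (step (e2 w) (x2^~ w) (n2 w) (fun i => (X2 i w)%:E))].
Proof.
move=> mu12 [m1 mX1 s1 l1 i1] [m2 mX2 s2 l2 i2] B mB.
pose Z d (O : measurableType d) (e : O -> R) x n (X : nat -> O -> R)
    (o : option nat) j :=
  if o is Some i then fun w => (X i w)%:E else data_code e x n j.
pose C : set (sequences_over (\bar R)) :=
  [set c | B (step (fine (decode (None : option nat) 0 c))
                   (fun j => fine (decode (None : option nat) j.+2 c))
                   (decode (None : option nat) 1 c)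
                   (fun i => decode (Some i) 0 c))].
have mC : measurable C.
  rewrite -[X in measurable X]setTI.
  have := @measurable_step R _ _ _ _ _ (fun i => @decode (option nat) (Some i) 0)
    (decode_data_meas (None : option nat)).
  by apply=> // i; exact: measurable_decode.
have E d (O : measurableType d) (e : O -> R) x n X :
    [set w | B (step (e w) (x^~ w) (n w) (fun i => (X i w)%:E))] =
    encode (Z d O e x n X) @^-1` C.
  rewrite /preimage/=; apply/funext => w /=; congr (B (step _ _ _ _));
    by apply/funext => j; rewrite decode_encode.
rewrite !E; apply: (encode_law_unique _ _ i1 i2) => //.
- move=> [i|] j /=; first exact/measurable_EFinP.
  exact: measurable_data_code.
- move=> [i|] j /=; first exact/measurable_EFinP.
  exact: measurable_data_code.
move=> [i|] D n mD DT /=; last first.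
  split; [exact: data_code_sigma|exact: data_code_sigma|].
  by rewrite !(data_code_event _ _ _ DT) -s1 ?s2// => *; exact: measurable_preimage_EFin.
(* A leaf block repeats the same variable at every position, so its event is a single preimage of an
   intersection. *)
have D'E d (O : measurableType d) (X : nat -> O -> R) :
    [set w | forall j, D j (X i w)%:E] = X i @^-1` (\bigcap_j (EFin @^-1` D j)).
  by apply/seteqP; split=> [w h j _|w h j]; [exact: h|exact: (h j I)].
have mD' : measurable (\bigcap_j (EFin @^-1` D j) : set R).
  by apply: bigcapT_measurable => j; exact: measurable_preimage_EFin.
rewrite !D'E l1// l2// mu12//; split=> //.
- by exists (\bigcap_j (EFin @^-1` D j)).
- by exists (\bigcap_j (EFin @^-1` D j)).
Qed.

Lemma TrelP (mu nu : probability R R) : Trel P0 eta xi N mu nu <->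
  forall d (Om : measurableType d) (P : probability Om R) e x n X,
  RDE_input mu P e x n X ->
  elaw_is P (fun w => step (e w) (x^~ w) (n w) (fun i => (X i w)%:E)) nu.
Proof.
split=> h d Om P e x n X => [[m mX s l i]|m mX s l i].
  have := h d Om P e x n X m mX s l i.
  by [].
by have := h d Om P e x n X (And5 m mX s l i).
Qed.

(** One realization of the input decides [Trel], since the law of the outcome is common to all
    realizations. *)
Lemma Trel_intro (mu nu : probability R R) d (Om : measurableType d)
    (P : probability Om R) e x n X : RDE_input mu P e x n X ->
  elaw_is P (fun w => step (e w) (x^~ w) (n w) (fun i => (X i w)%:E)) nu ->
  Trel P0 eta xi N mu nu.
Proof.
move=> H l; apply/TrelP => d' Om' P' e' x' n' X' H' B mB.
rewrite -l//; apply: (RDE_law_unique _ H' H) => //.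
exact: measurable_image_EFin.
Qed.

End Transfer.

(** * Canonical trees *)

Section CanonicalSpaces.
Context {R : realType}.
Local Open Scope ereal_scope.

Lemma prod_fset_widen {I : choiceType} (J : {fset I}) (s : seq I)
    (g : I -> \bar R) : uniq s -> {subset J <= s} ->
  (forall i, i \notin J -> g i = 1) ->
  \prod_(i <- s) g i = \prod_(i <- J) g i.
Proof.
move=> us Js g1; rewrite (bigID (mem J))/= [X in _ * X]big1 ?mule1//.
rewrite -big_filter; apply: perm_big; apply: uniq_perm.
- exact: filter_uniq.
- exact: fset_uniq.
- by move=> i; rewrite mem_filter andb_idr//; exact: Js.
Qed.

Lemma fset_nat_bound (J : {fset nat}) : exists m, forall i, i \in J -> (i < m)%N.
Proof.
exists (\sum_(i <- J) i.+1)%N => i iJ.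
by rewrite (big_rem i)//= leq_addr.
Qed.

Lemma infprod_fset {d} {T : measurableType d} (P : probability T R)
    {I : choiceType} (J : {fset I}) (h : I -> nat) (B : I -> set T) :
  injective h -> (forall i, i \in J -> measurable (B i)) ->
  infprod P [set x : sequences_over T | forall i, i \in J -> B i (x (h i))] =
  \prod_(i <- J) P (B i).
Proof.
move=> hI mB.
pose K := [fset h i | i in J]%fset.
have [m Km] := fset_nat_bound K.
pose B' k := [set t : T | forall i, i \in J -> h i = k -> B i t].
have B'h i : i \in J -> B' (h i) = B i.
  move=> iJ; apply/seteqP; split=> [t|t Bt j jJ /hI ->//].
  by move=> /(_ i iJ erefl).
have B'N k : k \notin K -> B' k = setT.
  move=> kK; apply/seteqP; split=> // t _ i iJ ik.
  by exfalso; move/negP: kK; apply; rewrite -ik; exact: in_imfset.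
have mB' k : measurable (B' k).
  have [/imfsetP[i /= iJ ->]|kK] := boolP (k \in K); first by rewrite B'h//; exact: mB.
  by rewrite B'N//; exact: measurableT.
have -> : [set x : sequences_over T | forall i, i \in J -> B i (x (h i))] =
    rect (B', m).
  apply/seteqP; split=> [x xB k i iJ <-|x xB i iJ]; first exact: xB.
  exact: (xB (h i)).
rewrite infprod_rect/=; last first.
  split=> //= k mk; apply: B'N; apply/negP => /Km.
  by rewrite ltnNge mk.
rewrite (@prod_fset_widen _ K)//.
- rewrite (perm_big [seq h i | i <- J])/=; last first.
    apply: uniq_perm; [exact: fset_uniq|by rewrite map_inj_uniq ?fset_uniq|].
    move=> k; apply/imfsetP/mapP => -[i iJ ->]; by exists i.
  by rewrite big_map; apply: eq_big_seq => i iJ; rewrite B'h.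
- by rewrite iota_uniq.
- by move=> k /Km km; rewrite mem_index_iota.
- by move=> k /B'N ->; rewrite probability_setT.
Qed.

Context {d0 : measure_display} {O0 : measurableType d0} (P0 : probability O0 R)
  (eta : O0 -> R) (xi : nat -> O0 -> R) (N : O0 -> \bar R).
Hypothesis mdata : data_meas eta xi N.

Lemma measurable_data_event n B0 B BN : measurable B0 ->
  (forall i, measurable (B i)) -> measurable BN ->
  measurable (data_event eta xi N n B0 B BN).
Proof.
move=> mB0 mB mBN; have [me mx mn] := mdata.
have -> : data_event eta xi N n B0 B BN = eta @^-1` B0 `&`
    (\bigcap_(i in `I_n) (xi i @^-1` B i)) `&` N @^-1` BN.
  by apply/seteqP; split=> w; [case=> h0 h hN; split|case=> -[]].
apply: measurableI; first apply: measurableI.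
- by rewrite -[X in measurable X]setTI; exact: me.
- apply: bigcap_measurableType => i _.
  by rewrite -[X in measurable X]setTI; exact: mx.
- by rewrite -[X in measurable X]setTI; exact: mn.
Qed.

Lemma data_meas_comp {d} {Om : measurableType d} (f : Om -> O0) :
  measurable_fun setT f ->
  data_meas (eta \o f) (fun i => xi i \o f) (N \o f).
Proof.
move=> mf; have [me mx mn] := mdata.
by split=> [|i|]; exact: measurableT_comp.
Qed.

(** The preimages under [f] of measurable sets form a sigma-algebra that contains the generators. *)
Lemma data_sigma_comp {d} {Om : measurableType d} (f : Om -> O0) D :
  data_sigma (eta \o f) (fun i => xi i \o f) (N \o f) D ->
  exists2 A, measurable A & D = f @^-1` A.
Proof.
have [me mx mn] := mdata.
have sP : sigma_algebra setT (preimage_set_system setT f (@measurable _ O0)).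
  apply: sigma_algebra_preimage; split=> //.
  - by move=> A mA; rewrite setTD; exact: measurableC.
  - by move=> F mF; exact: bigcupT_measurable.
move=> sD; have [A mA <-] : preimage_set_system setT f (@measurable _ O0) D.
  apply: smallest_sub sD => // E [[[B mB <-]|[i _ [B mB <-]]]|[B mB <-]].
  - exists (eta @^-1` B); last by rewrite setTI.
    by rewrite -[X in measurable X]setTI; exact: me.
  - exists (xi i @^-1` B); last by rewrite setTI.
    by rewrite -[X in measurable X]setTI; exact: mx.
  - exists (N @^-1` B); last by rewrite setTI.
    by rewrite -[X in measurable X]setTI; exact: mn.
by exists A => //; rewrite setTI.
Qed.

(** Placing independent samples of the whole space [O0] at the vertices is enough. This serves the
    canonical tree as well as the grafted one. *)
Lemma iid_tree_data {d} {Om : measurableType d} (P : probability Om R)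
    (f : seq nat -> Om -> O0) : (forall v, measurable_fun setT (f v)) ->
  (forall (J : {fset seq nat}) (B : seq nat -> set O0),
    (forall v, v \in J -> measurable (B v)) ->
    P [set w | forall v, v \in J -> B v (f v w)] = \prod_(v <- J) P0 (B v)) ->
  tree_data P0 eta xi N P (fun v => eta \o f v) (fun v i => xi i \o f v)
    (fun v => N \o f v).
Proof.
move=> mf iid.
have law v A : measurable A -> P (f v @^-1` A) = P0 A.
  move=> mA; have := iid [fset v]%fset (fun=> A) (fun _ _ => mA).
  rewrite big_seq_fset1 => <-; congr (P _); apply/seteqP; split=> [w wA u|w].
    by rewrite inE => /eqP ->.
  by move=> /(_ v); rewrite inE eqxx => /(_ isT).
split=> [v|v n B0 B BN mB0 mB mBN|J A JA].
- exact: data_meas_comp.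
- rewrite -(law v)//; exact: measurable_data_event.
have /choice[B BP] : forall v, exists B, v \in J ->
    measurable B /\ A v = f v @^-1` B.
  move=> v; have [vJ|] := boolP (v \in J); last by exists set0.
  by have [B mB AE] := data_sigma_comp (JA v vJ); exists B.
transitivity (P [set w | forall v, v \in J -> B v (f v w)]).
  congr (P _); apply/seteqP; split=> [w wA v vJ|w wB v /= vJ].
    by have := wA v vJ; have [_ ->] := BP v vJ.
  by have [_ ->] := BP v vJ; exact: wB.
rewrite iid; last by move=> v /BP[].
by apply: eq_big_seq => v /BP[mB ->]; rewrite law.
Qed.

Definition node (v : seq nat) (w : sequences_over O0) : O0 := w (choice.pickle v).

Lemma measurable_node v : measurable_fun setT (node v).
Proof. exact: measurable_coord. Qed.

Lemma node_indep (J : {fset seq nat}) (B : seq nat -> set O0) :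
  (forall v, v \in J -> measurable (B v)) ->
  infprod P0 [set w : sequences_over O0 | forall v, v \in J -> B v (node v w)] =
  \prod_(v <- J) P0 (B v).
Proof. by apply: infprod_fset; exact: (pcan_inj choice.pickleK). Qed.

End CanonicalSpaces.

(** * A root with i.i.d. leaves, and grafting *)

Section RootedProduct.
Context {R : realType} {d0 : measure_display} {O0 : measurableType d0}
  (P0 : probability O0 R).
Local Open Scope ereal_scope.

Section Forest.
Context {d} {T : measurableType d} (Q : probability T R).

Definition rooted : probability (O0 * sequences_over T)%type R :=
  (P0 \x infprod Q).

Lemma rooted_indep (A : set O0) (J : {fset nat}) (B : nat -> set T) :
  measurable A -> (forall i, i \in J -> measurable (B i)) ->
  rooted [set w | A w.1 /\ (forall i, i \in J -> B i (w.2 i))] =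
  P0 A * \prod_(i <- J) Q (B i).
Proof.
move=> mA mB.
have mJ : measurable
    [set x : sequences_over T | forall i, i \in J -> B i (x i)].
  have -> : [set x : sequences_over T | forall i, i \in J -> B i (x i)] =
      \bigcap_(i in [set` J]) [set x | B i (x i)] by [].
  apply: fin_bigcap_measurable => // i /= iJ.
  rewrite -[X in measurable X]setTI; apply: measurable_coord => //.
  exact: mB.
rewrite -(infprod_fset Q (h := id))// -product_measure1E//.
Qed.

Lemma measurable_leaf i : measurable_fun setT
  (fun w : O0 * sequences_over T => w.2 i).
Proof.
apply: (measurableT_comp (f := fun x : sequences_over T => x i)) => //.
exact: measurable_coord.
Qed.

Lemma rooted_fst A : measurable A -> rooted (fst @^-1` A) = P0 A.
Proof.
move=> mA; have := @rooted_indep A fset0 (fun=> setT) mA (fun _ _ => measurableT).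
rewrite big_seq_fset0 mule1 => <-; congr (rooted _).
by apply/seteqP; split=> [w wA|w []//]; split.
Qed.

Lemma rooted_leaf i A : measurable A ->
  rooted [set w | A (w.2 i)] = Q A.
Proof.
move=> mA.
have := @rooted_indep setT [fset i]%fset (fun=> A) measurableT (fun _ _ => mA).
rewrite big_seq_fset1 probability_setT mul1e => <-; congr (rooted _).
apply/seteqP; split=> [w wA|w [_ /(_ i)]] /=; last first.
  by rewrite inE eqxx; exact.
by split=> // j; rewrite inE => /eqP ->.
Qed.

(** The leaf space [T] is left free: [T = R] realizes a law itself, [T = R * R] a coupling of two
    laws, and a space of trees the subtrees below the root. *)
Lemma rooted_input (eta : O0 -> R) (xi : nat -> O0 -> R) (N : O0 -> \bar R)
    (f : T -> R) (mu : probability R R) :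
  data_meas eta xi N -> measurable_fun setT f ->
  (forall A, measurable A -> mu A = Q (f @^-1` A)) ->
  RDE_input P0 eta xi N mu rooted (eta \o fst) (fun i => xi i \o fst) (N \o fst)
    (fun i w => f (w.2 i)).
Proof.
move=> mdata mf muQ.
have mpre (B : set R) : measurable B -> measurable (f @^-1` B).
  by move=> mB; rewrite -[X in measurable X]setTI; exact: mf.
split.
- exact: data_meas_comp.
- by move=> i; apply: (measurableT_comp mf); exact: measurable_leaf.
- move=> n B0 B BN mB0 mB mBN; rewrite -rooted_fst//.
  exact: measurable_data_event.
- by move=> i B mB; rewrite muQ// -(rooted_leaf i)//; exact: mpre.
- move=> J A JA.
  pose K := [fset odflt 0%N o | o in J & o != None]%fset.
  have KP i : (i \in K) = (Some i \in J).
    apply/imfsetP/idP => [[[j|]]|iJ]; rewrite ?inE ?andbF//.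
      by rewrite andbT => jJ /= ->.
    by exists (Some i); rewrite // inE iJ.
  have [A0 mA0 A0E] : exists2 A0, measurable A0 &
      None \in J -> A None = fst @^-1` A0.
    have [NJ|_] := boolP (None \in J); last by exists set0.
    by have [A0 mA0 ->] := data_sigma_comp mdata (JA None NJ); exists A0.
  pose A0' := if None \in J then A0 else setT.
  have mA0' : measurable A0' by rewrite /A0'; case: ifP.
  have /choice[B BP] : forall i, exists B, Some i \in J ->
      measurable B /\ A (Some i) = [set w | B (w.2 i)].
    move=> i; have [iJ|] := boolP (Some i \in J); last by exists set0.
    have [B mB BE] := JA _ iJ; exists (f @^-1` B) => _.
    by split=> //; exact: mpre.
  transitivity (rooted [set w | A0' w.1 /\ (forall i, i \in K -> B i (w.2 i))]).
    congr (rooted _); apply/seteqP; split=> [w wA|w [wA wB] [i|]] /=.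
    - split=> [|i]; last first.
        by rewrite KP => iJ; have := wA _ iJ; have [_ ->] := BP i iJ.
      rewrite /A0'; case: ifP => // NJ.
      by have := wA None NJ; rewrite A0E.
    - by move=> iJ; have [_ ->] := BP i iJ; apply: wB; rewrite KP.
    - by move=> NJ; rewrite A0E//; move: wA; rewrite /A0' NJ.
  rewrite rooted_indep//; last by move=> i; rewrite KP => /BP[].
  pose g o := if o \in J then rooted (A o) else 1.
  transitivity (\prod_(o <- J) g o); last first.
    by apply: eq_big_seq => o oJ; rewrite /g oJ.
  (* The list enumerates [J], with [None] possibly added; [g] is 1 at an added index. *)
  rewrite -(@prod_fset_widen R _ J (None :: [seq Some i | i <- K]))/=.
  + rewrite big_cons big_map; congr (_ * _).
      rewrite /g /A0'; case: ifP => NJ; last by rewrite probability_setT.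
      by rewrite A0E// rooted_fst.
    apply: eq_big_seq => i iK; have iJ : Some i \in J by rewrite -KP.
    by have [mB E] := BP i iJ; rewrite /g iJ E rooted_leaf.
  + rewrite map_inj_uniq ?fset_uniq ?andbT; last by move=> i j [].
    by apply/mapP => -[].
  + move=> [i|] iJ; rewrite inE//=; apply/mapP; exists i => //.
    by rewrite -KP in iJ.
  + by move=> o oJ; rewrite /g (negbTE oJ).
Qed.

End Forest.

(* The sequence of trees [w.2] grafted below the root datum [w.1]. *)
Definition graft_node (v : seq nat)
    (w : O0 * sequences_over (sequences_over O0)) : O0 :=
  if v is i :: u then node u (w.2 i) else w.1.

Lemma measurable_graft_node v : measurable_fun setT (graft_node v).
Proof.
case: v => [|i u] /=; first exact: measurable_fst.
apply: (measurableT_comp (f := node u)); first exact: measurable_node.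
exact: measurable_leaf.
Qed.

(** Group the vertices of [J] by first letter. The root and the subtrees are independent by
    [rooted_indep], and the tails [Ji i] inside one subtree by [node_indep]. *)
Lemma graft_node_indep (J : {fset seq nat}) (B : seq nat -> set O0) :
  (forall v, v \in J -> measurable (B v)) ->
  rooted (infprod P0) [set w | forall v, v \in J -> B v (graft_node v w)] =
  \prod_(v <- J) P0 (B v).
Proof.
move=> mB.
pose K := [fset head 0%N v | v in J]%fset.
pose Ji i := [fset behead v | v in J & i :: behead v \in J]%fset.
have JiP i u : (u \in Ji i) = (i :: u \in J).
  apply/imfsetP/idP => [[v /=]|iuJ]; first by rewrite inE => /andP[_ ?] ->.
  by exists (i :: u); rewrite //= inE iuJ.
have KP i u : i :: u \in J -> i \in K.
  by move=> iuJ; apply/imfsetP; exists (i :: u).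
pose A0 := [set t | [::] \in J -> B [::] t].
have mA0 : measurable A0.
  rewrite /A0; have [NJ|NJ] := boolP ([::] \in J).
    have -> : [set t | true -> B [::] t] = B [::].
      by apply/seteqP; split=> [t /(_ isT)|t Bt _].
    exact: mB.
  have -> : [set t | false -> B [::] t] = setT by apply/seteqP; split.
  exact: measurableT.
pose C i := [set x : sequences_over O0 | forall u, u \in Ji i -> B (i :: u) (node u x)].
have mC i : measurable (C i).
  have -> : C i = \bigcap_(u in [set` Ji i]) [set x | B (i :: u) (node u x)] by [].
  apply: fin_bigcap_measurable => // u /= uJ.
  rewrite -[X in measurable X]setTI; apply: measurable_node => //.
  by apply: mB; rewrite -JiP.
transitivity (rooted (infprod P0)
    [set w | A0 w.1 /\ (forall i, i \in K -> C i (w.2 i))]).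
  congr (rooted _ _); apply/seteqP; split=> [w wB|w [wA wC] [|i u] vJ] /=.
  - split=> [|i iK u]; first exact: (wB [::]).
    by rewrite JiP => /wB.
  - exact: wA.
  - by apply: wC; [exact: KP vJ|rewrite JiP].
rewrite rooted_indep//.
pose g v := if v \in J then P0 (B v) else 1.
transitivity (\prod_(v <- J) g v); last first.
  by apply: eq_big_seq => v vJ; rewrite /g vJ.
pose s := [seq i :: u | i <- K, u <- Ji i].
rewrite -(@prod_fset_widen R _ J ([::] :: s))/=.
- rewrite big_cons big_allpairs_dep; congr (_ * _).
    rewrite /g /A0; case: ifP => NJ.
      by congr (P0 _); apply/seteqP; split=> [t /(_ isT)|t Bt _].
    rewrite -(probability_setT P0); congr (P0 _).
    by apply/seteqP; split.
  apply: eq_bigr => i _; rewrite /C (@node_indep _ _ _ P0 (Ji i) (fun u => B (i :: u))); last first.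
    by move=> u uJ; apply: mB; rewrite -JiP.
  by apply: eq_big_seq => u; rewrite JiP /g => ->.
- apply/andP; split; first by apply/allpairsPdep => -[i [u []]].
  apply: allpairs_uniq_dep; [exact: fset_uniq|by move=> i _; exact: fset_uniq|].
  by move=> [i u] [j v] _ _ [-> ->].
- move=> [|i u] vJ; rewrite inE//=; apply/allpairsPdep.
  by exists i, u; split; [exact: KP vJ|rewrite JiP|].
- by move=> v vJ; rewrite /g (negbTE vJ).
Qed.

End RootedProduct.

(** * The path supremum as a limit of iterates *)

Section PathSup.
Context {R : realType}.
Local Open Scope ereal_scope.
Implicit Types (e : seq nat -> R) (x : seq nat -> nat -> R) (m : seq nat -> \bar R).

Definition path_weight e x (v : seq nat) : R :=
  @Wpath R _ unit (fun u _ => e u) (fun u j _ => x u j) tt v.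

Definition in_tree_of m (v : seq nat) : Prop :=
  @in_tree R _ unit (fun u _ => m u) tt v.

Definition subtree {T : Type} (f : seq nat -> T) (j : nat) (v : seq nat) : T :=
  f (j :: v).

Lemma path_weight0 e x : path_weight e x [::] = e [::].
Proof. by rewrite /path_weight /Wpath big_ord1 big_ord0 mulr1. Qed.

Lemma path_weight_cons e x j u : path_weight e x (j :: u) =
  (e [::] + x [::] j * path_weight (subtree e j) (subtree x j) u)%R.
Proof.
rewrite /path_weight /Wpath big_ord_recl/= big_ord0 mulr1; congr (_ + _)%R.
rewrite mulr_sumr; apply: eq_bigr => k _.
by rewrite big_ord_recl/= mulrCA.
Qed.

Lemma in_tree_of_cons m j u : in_tree_of m (j :: u) <->
  le_star j (m [::]) /\ in_tree_of (subtree m j) u.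
Proof.
split=> [h|[h0 h] [|k] ku]; last 2 first.
- exact: h0.
- exact: (h k).
by split=> [|k ku]; [exact: (h 0%N)|exact: (h k.+1)].
Qed.

Lemma path_supE e x m :
  path_sup e x m = ereal_sup [set (path_weight e x v)%:E | v in in_tree_of m].
Proof. by []. Qed.

Lemma sup_nn_ge0 (S : set (\bar R)) : 0 <= sup_nn S.
Proof. by apply: ereal_sup_ubound; left. Qed.

Lemma sup_nn_ub (S : set (\bar R)) y : S y -> y <= sup_nn S.
Proof. by move=> Sy; apply: ereal_sup_ubound; right. Qed.

Lemma sup_nn_le (S : set (\bar R)) z : 0 <= z -> (forall y, S y -> y <= z) ->
  sup_nn S <= z.
Proof. by move=> z0 Sz; apply: ge_ereal_sup => y [->//|/Sz]. Qed.

Lemma le_step (e : R) (x : nat -> R) (n : \bar R) (y z : nat -> \bar R) :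
  (forall j, 0 <= x j)%R -> (forall j, le_star j n -> y j <= z j) ->
  step e x n y <= step e x n z.
Proof.
move=> x0 yz; rewrite leeD2l// sup_nn_le ?sup_nn_ge0// => _ [j jn <-].
apply: le_trans (sup_nn_ub _); last by exists j.
by apply: lee_wpmul2l; [rewrite lee_fin|exact: yz].
Qed.

Lemma step_ge0 (e : R) (x : nat -> R) (n : \bar R) (y : nat -> \bar R) :
  (0 <= e)%R -> 0 <= step e x n y.
Proof. by move=> e0; rewrite adde_ge0 ?lee_fin ?sup_nn_ge0. Qed.

(** Paths are split by their first edge. The path reduced to the root accounts for the 0 adjoined by
    [sup_nn]; nonnegative weights let multiplication commute with the supremum over the paths
    through one child. *)
Lemma path_sup_step e x m : (forall j, 0 <= x [::] j)%R ->
  path_sup e x m = step (e [::]) (x [::]) (m [::])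
    (fun j => path_sup (subtree e j) (subtree x j) (subtree m j)).
Proof.
move=> x0; apply/eqP; rewrite eq_le; apply/andP; split.
  apply: ge_ereal_sup => _ [[|j u] vm <-]; rewrite -/(path_weight e x _).
    by rewrite path_weight0 leeDl// sup_nn_ge0.
  have [jm um] := (in_tree_of_cons _ _ _).1 vm.
  rewrite path_weight_cons EFinD leeD2l// EFinM.
  apply: le_trans (sup_nn_ub _); last by exists j.
  apply: lee_wpmul2l; first by rewrite lee_fin.
  by apply: ereal_sup_ubound; exists u.
rewrite /step -leeBrDl//.
apply: sup_nn_le => [|_ [j jm <-]].
  rewrite leeBrDl// adde0; apply: ereal_sup_ubound; exists [::] => //.
  by rewrite -/(path_weight e x _) path_weight0.
rewrite path_supE -ereal_supZl//; last first.
  by apply/set0P; exists (path_weight (subtree e j) (subtree x j) [::])%:E; exists [::].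
apply: ge_ereal_sup => _ [_ [u um <-] <-]; rewrite leeBrDl//.
rewrite -EFinM -EFinD -path_weight_cons; apply: ereal_sup_ubound.
by exists (j :: u) => //; exact/in_tree_of_cons.
Qed.

(** [depth_sum] descends by appending a letter, as the recursion of an RTP does, whereas grafting
    prepends one; this shift of origin reconciles the two. *)
Lemma depth_sum_subtree n e x m j v :
  depth_sum n (subtree e j) (subtree x j) (subtree m j) v =
  depth_sum n e x m (j :: v).
Proof.
elim: n v => [//|n IH] v /=; congr (step _ _ _ _).
by apply/funext => i; exact: IH.
Qed.

Lemma depth_sumS n e x m : depth_sum n.+1 e x m [::] =
  step (e [::]) (x [::]) (m [::])
    (fun j => depth_sum n (subtree e j) (subtree x j) (subtree m j) [::]).
Proof.
rewrite /=; congr (step _ _ _ _); apply/funext => j.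
by rewrite depth_sum_subtree.
Qed.

Definition nonneg_data e x := (forall v, 0 <= e v)%R /\ (forall v j, 0 <= x v j)%R.

Lemma depth_sum_ge0 n e x m v : nonneg_data e x -> 0 <= depth_sum n e x m v.
Proof. by case: n => [//|n] [e0 _]; exact: step_ge0. Qed.

(** The iteration starts at 0, below [Y], and monotonicity of [step] keeps it below. *)
Lemma depth_sum_le_fix n e x m (Y : seq nat -> \bar R) v :
  (forall v j, 0 <= x v j)%R -> (forall v, 0 <= Y v) ->
  (forall v, Y v = step (e v) (x v) (m v) (fun j => Y (rcons v j))) ->
  depth_sum n e x m v <= Y v.
Proof.
move=> x0 Y0 YE; elim: n v => [//|n IH] v; rewrite YE /=.
by apply: le_step => // j _; exact: IH.
Qed.

Lemma nondecreasing_depth_sum e x m v : nonneg_data e x ->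
  {homo (fun n => depth_sum n e x m v) : n p / (n <= p)%N >-> n <= p}.
Proof.
move=> ex0; apply/nondecreasing_seqP => n.
elim: n v => [|n IH] v; first by rewrite depth_sum_ge0.
by apply: le_step => [|j _]; [exact: ex0.2|exact: IH].
Qed.

Lemma path_sup_ge0 e x m : (0 <= e [::])%R -> 0 <= path_sup e x m.
Proof.
move=> e0; apply: le_trans (ereal_sup_ubound _); last by exists [::].
by rewrite -/(path_weight e x _) path_weight0 lee_fin.
Qed.

Lemma depth_sum_le_path_sup n e x m : nonneg_data e x ->
  depth_sum n e x m [::] <= path_sup e x m.
Proof.
elim: n e x m => [|n IH] e x m [e0 x0]; first exact: path_sup_ge0.
rewrite depth_sumS path_sup_step//; apply: le_step => // j _.
by apply: IH; split=> [v|v i]; [exact: e0|exact: x0].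
Qed.

(** A path with [size v] edges has one more vertex, hence the truncation level. *)
Lemma path_weight_le_depth_sum e x m v : nonneg_data e x -> in_tree_of m v ->
  (path_weight e x v)%:E <= depth_sum (size v).+1 e x m [::].
Proof.
elim: v e x m => [|j u IH] e x m [e0 x0] vm; rewrite depth_sumS.
  by rewrite path_weight0 leeDl// sup_nn_ge0.
have [jm um] := (in_tree_of_cons _ _ _).1 vm.
rewrite path_weight_cons EFinD leeD2l// EFinM.
apply: le_trans (sup_nn_ub _); last by exists j.
apply: lee_wpmul2l; first by rewrite lee_fin.
by apply: IH => //; split=> [v|v i]; [exact: e0|exact: x0].
Qed.

Lemma cvg_depth_sum e x m : nonneg_data e x ->
  depth_sum n e x m [::] @[n --> \oo] --> path_sup e x m.
Proof.
move=> ex0.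
have -> : path_sup e x m = ereal_sup (range (fun n => depth_sum n e x m [::])).
  apply/eqP; rewrite eq_le; apply/andP; split.
    apply: ge_ereal_sup => _ [v vm <-].
    apply: le_trans (path_weight_le_depth_sum ex0 vm) _.
    by apply: ereal_sup_ubound; exists (size v).+1.
  apply: ge_ereal_sup => _ [n _ <-]; exact: depth_sum_le_path_sup.
exact: ereal_nondecreasing_cvgn (nondecreasing_depth_sum _ _ ex0).
Qed.

(** Minimality of the tree sum among the nonnegative solutions along the tree; endogeny applies it
    to each realization of an RTP. *)
Lemma path_sup_le_fix e x m (Y : seq nat -> \bar R) :
  nonneg_data e x -> (forall v, 0 <= Y v) ->
  (forall v, Y v = step (e v) (x v) (m v) (fun j => Y (rcons v j))) ->
  path_sup e x m <= Y [::].
Proof.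
move=> ex0 Y0 YE; apply: ge_ereal_sup => _ [v vm <-].
apply: le_trans (path_weight_le_depth_sum ex0 vm) _.
by apply: depth_sum_le_fix => //; exact: ex0.2.
Qed.

End PathSup.

(** * Moment estimates *)

Section Estimates.
Context {R : realType}.
Local Open Scope ereal_scope.

Lemma ge0_integral_law {d d'} {Om : measurableType d} {T : measurableType d'}
    (P : probability Om R) (nu : probability T R) (f : Om -> T) (G : T -> \bar R) :
  measurable_fun setT f -> (forall A, measurable A -> nu A = P (f @^-1` A)) ->
  measurable_fun setT G -> (forall x, 0 <= G x) ->
  \int[nu]_x G x = \int[P]_w G (f w).
Proof.
move=> mf nuE mG G0.
have := @ge0_integral_pushforward _ _ _ _ R f mf P setT G measurableT mG
  (fun y _ => G0 y).
rewrite preimage_setT => <-; apply: eq_measure_integral => A mA _.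
exact: nuE.
Qed.

Lemma poweR_sup_nn_le (a : nat -> \bar R) (S : set nat) (p : R) : (0 < p)%R ->
  (forall j, 0 <= a j) ->
  sup_nn [set a j | j in S] `^ p <= \sum_(j <oo) (\1_S j)%:E * a j `^ p.
Proof.
move=> p0 a0; set s := \sum_(j <oo) _.
have t0 j : 0 <= (\1_S j)%:E * a j `^ p by rewrite mule_ge0 ?lee_fin ?poweR_ge0.
have s0 : 0 <= s by rewrite nneseries_ge0.
(* Once [s] is written as a power, it suffices to compare each [a j] with the root of [s], and [a j]
   is the root of a single term. *)
have -> : s = (s `^ p^-1) `^ p.
  by rewrite -poweRrM mulVf ?gt_eqF// poweRe1.
apply: gt0_ler_poweR; rewrite ?(ltW p0)// ?in_itv/= ?leey ?sup_nn_ge0 ?poweR_ge0//.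
apply: sup_nn_le; first exact: poweR_ge0.
move=> _ [j Sj <-].
have -> : a j = (a j `^ p) `^ p^-1.
  by rewrite -poweRrM mulfV ?gt_eqF// poweRe1.
apply: gt0_ler_poweR; rewrite ?invr_ge0 ?(ltW p0)// ?in_itv/= ?leey ?poweR_ge0 ?s0//.
apply: le_trans (nneseries_lim_ge j.+1 _) => //.
rewrite big_mkord (bigD1 ord_max)//= indicE mem_set// mul1e.
by rewrite leeDl// sume_ge0.
Qed.

Lemma nneseriesMr_le (a : nat -> \bar R) (c : \bar R) : (forall i, 0 <= a i) ->
  0 <= c -> \sum_(i <oo) a i * c <= (\sum_(i <oo) a i) * c.
Proof.
move=> a0 c0; apply: lime_le.
  by apply: is_cvg_nneseries => i _ _; rewrite mule_ge0.
apply: nearW => n; rewrite -ge0_sume_distrl//.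
by apply: lee_wpmul2r => //; apply: nneseries_lim_ge.
Qed.

Section RootedEstimates.
Context {d0 : measure_display} {O0 : measurableType d0} (P0 : probability O0 R)
  (eta : O0 -> R) (xi : nat -> O0 -> R) (N : O0 -> \bar R).
Hypothesis mdata : data_meas eta xi N.
Hypothesis eta_ge0 : forall w, (0 <= eta w)%R.
Hypothesis xi_ge0 : forall i w, (0 <= xi i w)%R.
Context {d} {T : measurableType d} (Q : probability T R) (g : T -> \bar R).
Hypothesis mg : measurable_fun setT g.
Hypothesis g_ge0 : forall t, 0 <= g t.

Let cpterm p i (w : O0) : R :=
  (\1_[set w' | le_star i (N w')] w * (xi i w `^ p))%R.

Let measurable_cpterm p i : measurable_fun setT (cpterm p i).
Proof.
have [_ mx mn] := mdata.
apply: measurable_funM; first by apply: measurable_indic; exact: measurable_le_star.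
by apply: (measurableT_comp (f := fun y : R => (y `^ p)%R)); [exact: measurable_powR|exact: mx].
Qed.

Let cpterm_ge0 p i w : (0 <= cpterm p i w)%R.
Proof. by rewrite mulr_ge0 ?powR_ge0. Qed.

Definition leaf_sup (w : O0 * sequences_over T) : \bar R :=
  sup_nn [set (xi i w.1)%:E * g (w.2 i) | i in [set i | le_star i (N w.1)]].

Lemma measurable_leaf_sup : measurable_fun setT leaf_sup.
Proof.
have [_ mx mn] := mdata.
apply: (@measurable_sup_nn R _ (O0 * sequences_over T)%type
  (fun i w => (xi i w.1)%:E * g (w.2 i)) (fun w => N w.1)) => [i|]; last exact: measurableT_comp.
apply: emeasurable_funM.
  by apply/measurable_EFinP; apply: measurableT_comp; [exact: mx|].
by apply: (measurableT_comp mg); exact: measurable_leaf.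
Qed.

(** After the pointwise bound by a series, Tonelli factors every term: the weight lives on the root
    factor, the leaf on the other, and all leaves have the same moment. *)
Lemma integral_leaf_sup_le p : (0 < p)%R ->
  \int[rooted P0 Q]_w (leaf_sup w `^ p) <= cp P0 xi N p * \int[Q]_t (g t `^ p).
Proof.
move=> p0.
have mgp : measurable_fun setT (fun t => g t `^ p).
  by apply: (measurableT_comp (f := fun y : \bar R => y `^ p)) => //; exact: measurable_poweR.
pose h i (w : O0 * sequences_over T) := (cpterm p i w.1)%:E * g (w.2 i) `^ p.
have h0 i w : 0 <= h i w by rewrite mule_ge0 ?lee_fin ?poweR_ge0.
have mh i : measurable_fun setT (h i).
  apply: emeasurable_funM.
    by apply/measurable_EFinP; apply: measurableT_comp.
  by apply: (measurableT_comp mgp); exact: measurable_leaf.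
apply: (@le_trans _ _ (\int[rooted P0 Q]_w (\sum_(i <oo) h i w))).
  apply: ge0_le_integral => //.
  - by move=> w _; exact: poweR_ge0.
  - apply: (measurableT_comp (f := fun y : \bar R => y `^ p)); first exact: measurable_poweR.
    exact: measurable_leaf_sup.
  - by apply: ge0_emeasurable_sum.
  move=> w _; apply: le_trans (poweR_sup_nn_le _ p0 _) _ => [j|].
    by rewrite mule_ge0 ?lee_fin.
  apply: lee_nneseries => [j _ _|j _].
    by rewrite mule_ge0 ?lee_fin ?poweR_ge0.
  by rewrite /h /cpterm poweRM ?lee_fin// poweR_EFin EFinM muleA indicE.
rewrite integral_nneseries//.
have E i : \int[rooted P0 Q]_w h i w =
    (\int[P0]_w (cpterm p i w)%:E) * \int[Q]_t (g t `^ p).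
  rewrite /rooted fubini_tonelli1//=.
  transitivity (\int[P0]_w ((cpterm p i w)%:E * \int[Q]_t (g t `^ p))).
    apply: eq_integral => w _; rewrite /fubini_F /h/= ge0_integralZl//.
    - congr (_ * _); symmetry.
      apply: (ge0_integral_law (P := infprod Q) (f := fun x => x i)) => //.
      + exact: measurable_coord.
      + move=> A mA.
        rewrite -(rooted_leaf P0 Q i mA).
        have -> : [set w | A (w.2 i)] =
            (@setT O0) `*` ((fun x : sequences_over T => x i) @^-1` A).
          by apply/seteqP; split=> [v|v []].
        have mA' : measurable ((fun x : sequences_over T => x i) @^-1` A).
          by rewrite -[X in measurable X]setTI; exact: measurable_coord.
        rewrite /rooted/= product_measure1E// -[RHS]mul1e.
        by congr (_ * _); exact: probability_setT.
      + by move=> t; exact: poweR_ge0.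
    - by apply: (measurableT_comp mgp); exact: measurable_coord.
    - by move=> x _; exact: poweR_ge0.
    - by rewrite lee_fin.
  rewrite ge0_integralZr//.
  - by apply/measurable_EFinP.
  - by move=> w _; rewrite lee_fin.
  - by apply: integral_ge0 => t _; exact: poweR_ge0.
under eq_eseriesr do rewrite E.
apply: nneseriesMr_le => [i|]; last by apply: integral_ge0 => t _; exact: poweR_ge0.
by apply: integral_ge0 => w _; rewrite lee_fin.
Qed.

End RootedEstimates.
End Estimates.

Section MomentBounds.
Context {R : realType}.
Local Open Scope ereal_scope.

(** As [t] tends to 0 the factor of [b] tends to 1, at the price of a large factor in front of
    [a]. *)
Lemma powR_add_le (p t : R) (a b : R) : (0 < p)%R -> (0 < t)%R -> (0 <= a)%R ->
  (0 <= b)%R ->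
  ((a + b) `^ p <= (1 + t^-1) `^ p * a `^ p + (1 + t) `^ p * b `^ p)%R.
Proof.
move=> p0 t0 a0 b0.
have it0 : (0 < t^-1)%R by rewrite invr_gt0.
(* The sum is at most (1 + t) b or (1 + t^-1) a. *)
have [ab|ba] := leP a (t * b)%R.
- apply: (@le_trans _ _ (((1 + t) * b) `^ p)%R).
    apply: ge0_ler_powR; rewrite ?nnegrE ?(ltW p0) ?addr_ge0 ?mulr_ge0 ?addr_ge0 ?(ltW t0)//.
    by rewrite mulrDl mul1r addrC lerD2l.
  rewrite powRM ?addr_ge0 ?(ltW t0)// lerDr mulr_ge0 ?powR_ge0//.
- apply: (@le_trans _ _ (((1 + t^-1) * a) `^ p)%R).
    apply: ge0_ler_powR; rewrite ?nnegrE ?(ltW p0) ?addr_ge0 ?mulr_ge0 ?addr_ge0 ?(ltW it0)//.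
    by rewrite mulrDl mul1r lerD2l mulrC ler_pdivlMr// mulrC ltW.
  rewrite powRM ?addr_ge0 ?(ltW it0)// lerDl mulr_ge0 ?powR_ge0//.
Qed.

Lemma poweR_add_le (p t : R) (a : R) (b : \bar R) : (0 < p)%R -> (0 < t)%R ->
  (0 <= a)%R -> 0 <= b ->
  (a%:E + b) `^ p <=
  ((1 + t^-1) `^ p)%:E * (a `^ p)%:E + ((1 + t) `^ p)%:E * b `^ p.
Proof.
move=> p0 t0 a0; case: b => [b b0||//]; last first.
  move=> _; rewrite [in leRHS]poweRyr ?gt_eqF//.
  by rewrite gt0_muley ?lte_fin ?powR_gt0 ?addr_gt0 ?invr_gt0// -EFinM addey ?leey.
by rewrite -EFinD !poweR_EFin -!EFinM -EFinD lee_fin powR_add_le.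
Qed.

Lemma exists_dilation (p c : R) : (0 < p)%R -> (0 <= c < 1)%R ->
  exists2 t, (0 < t)%R & ((1 + t) `^ p * c < 1)%R.
Proof.
(* [k] is the midpoint of [c] and 1. With [s] the [p]-th root of [k] and [1 + t = s^-1], the product
   becomes [c / k]. *)
move=> p0 /andP[c0 c1]; pose k := ((1 + c) / 2)%R.
have k0 : (0 < k)%R by rewrite divr_gt0// ltr_wpDr.
have k1 : (k < 1)%R by rewrite /k ltr_pdivrMr// mul1r -[ltRHS]natr1 addrC ltrD2r.
have ck : (c < k)%R by rewrite /k ltr_pdivlMr// mulr_natr mulr2n ltrD2r.
pose s := (k `^ p^-1)%R.
have s0 : (0 < s)%R by rewrite powR_gt0.
have sp : (s `^ p = k)%R.
  by rewrite -powRrM mulVf ?gt_eqF// powRr1// ltW.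
have s1 : (s < 1)%R.
  rewrite ltNge; apply/negP => s1.
  have : (1 `^ p <= s `^ p)%R.
    by apply: ge0_ler_powR; rewrite ?nnegrE ?(ltW p0) ?(ltW s0).
  by rewrite powR1 sp leNgt k1.
exists (s^-1 - 1)%R; first by rewrite subr_gt0 invf_gt1.
rewrite addrCA subrr addr0 -powR_inv1 ?(ltW s0)// -powRrM mulrC mulN1r.
have -> : (c * s `^ (- p) = c / k)%R by rewrite powRN sp.
by rewrite ltr_pdivrMr// mul1r.
Qed.

Context {d0 : measure_display} {O0 : measurableType d0} (P0 : probability O0 R)
  (eta : O0 -> R) (xi : nat -> O0 -> R) (N : O0 -> \bar R).
Hypothesis mdata : data_meas eta xi N.
Hypothesis eta_ge0 : forall w, (0 <= eta w)%R.
Hypothesis xi_ge0 : forall i w, (0 <= xi i w)%R.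

Definition rooted_step {T : Type} (g : T -> \bar R) (w : O0 * (nat -> T)) : \bar R :=
  step (eta w.1) (xi^~ w.1) (N w.1) (fun i => g (w.2 i)).

Section Leaves.
Context {d} {T : measurableType d} (Q : probability T R).

Lemma measurable_rooted_step (g : T -> \bar R) : measurable_fun setT g ->
  measurable_fun setT (rooted_step g : O0 * sequences_over T -> \bar R).
Proof.
move=> mg.
apply: (@measurable_step R _ (O0 * sequences_over T)%type (eta \o fst)
  (fun i => xi i \o fst) (N \o fst) (fun i w => g (w.2 i))).
  exact: data_meas_comp.
by move=> i; apply: (measurableT_comp mg); exact: measurable_leaf.
Qed.

Lemma integral_rooted_step_le p t (g : T -> \bar R) : (0 < p)%R -> (0 < t)%R ->
  measurable_fun setT g -> (forall x, 0 <= g x) ->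
  \int[rooted P0 Q]_w (rooted_step g w `^ p) <=
  ((1 + t^-1) `^ p)%:E * \int[P0]_w (eta w `^ p)%:E +
  ((1 + t) `^ p)%:E * (cp P0 xi N p * \int[Q]_x (g x `^ p)).
Proof.
move=> p0 t0 mg g0.
have mpow : measurable_fun setT (fun y : \bar R => y `^ p) by exact: measurable_poweR.
have meta : measurable_fun setT (fun w : O0 => (eta w `^ p)%:E).
  apply/measurable_EFinP; case: mdata => me _ _.
  by apply: (measurableT_comp (f := fun y : R => (y `^ p)%R)); first exact: measurable_powR.
have mleaf := measurable_leaf_sup mdata mg.
apply: (@le_trans _ _ (\int[rooted P0 Q]_w
    (((1 + t^-1) `^ p)%:E * (eta w.1 `^ p)%:E +
     ((1 + t) `^ p)%:E * leaf_sup xi N g w `^ p))).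
  apply: ge0_le_integral => //.
  - by move=> w _; exact: poweR_ge0.
  - by apply: (measurableT_comp mpow); exact: measurable_rooted_step.
  - apply: emeasurable_funD; apply: measurable_funeM.
      by apply: (measurableT_comp meta).
    by apply: (measurableT_comp mpow); exact: mleaf.
  - by move=> w _; apply: poweR_add_le => //; exact: sup_nn_ge0.
rewrite ge0_integralD//.
- apply: leeD.
    rewrite ge0_integralZl//.
    + apply: lee_wpmul2l; first by rewrite lee_fin powR_ge0.
      rewrite -(ge0_integral_law (P := rooted P0 Q) (nu := P0) (f := fst)
        (G := fun w => (eta w `^ p)%:E))//.
      * by move=> A mA; rewrite rooted_fst.
      * by move=> w; rewrite lee_fin powR_ge0.
    + by apply: (measurableT_comp meta).
    + by move=> w _; rewrite lee_fin powR_ge0.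
    + by rewrite lee_fin powR_ge0.
  rewrite ge0_integralZl//.
  + apply: lee_wpmul2l; first by rewrite lee_fin powR_ge0.
    by apply: (integral_leaf_sup_le _ mdata).
  + by apply: (measurableT_comp mpow).
  + by move=> w _; exact: poweR_ge0.
  + by rewrite lee_fin powR_ge0.
- by move=> w _; rewrite mule_ge0 ?lee_fin ?powR_ge0.
- by apply: measurable_funeM; apply: (measurableT_comp meta).
- by move=> w _; rewrite mule_ge0 ?lee_fin ?powR_ge0 ?poweR_ge0.
- by apply: measurable_funeM; apply: (measurableT_comp mpow).
Qed.

End Leaves.

Lemma cp_ge0 p : 0 <= cp P0 xi N p.
Proof.
by apply: nneseries_ge0 => i _ _; apply: integral_ge0 => w _; rewrite lee_fin mulr_ge0 ?powR_ge0.
Qed.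

Lemma cp_fin_num p : cp P0 xi N p < 1 -> cp P0 xi N p \is a fin_num.
Proof. by move=> c1; rewrite ge0_fin_numE ?cp_ge0// (lt_trans c1)// ltry. Qed.

(** The constants are fixed before the leaf law, so the estimate can be iterated along the truncated
    sums. *)
Lemma step_moment_contraction p : (0 < p)%R -> cp P0 xi N p < 1 ->
  exists A r : R, [/\ (0 <= A)%R, (0 <= r < 1)%R &
  forall d (T : measurableType d) (Q : probability T R) (g : T -> \bar R),
    measurable_fun setT g -> (forall x, 0 <= g x) ->
    \int[rooted P0 Q]_w (rooted_step g w `^ p) <=
    A%:E * \int[P0]_w (eta w `^ p)%:E + r%:E * \int[Q]_x (g x `^ p)].
Proof.
move=> p0 c1.
have cfin := cp_fin_num c1.
have c01 : (0 <= fine (cp P0 xi N p) < 1)%R.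
  by rewrite fine_ge0 ?cp_ge0//= -lte_fin fineK.
have [t t0 tc] := exists_dilation p0 c01.
exists ((1 + t^-1) `^ p)%R, ((1 + t) `^ p * fine (cp P0 xi N p))%R; split.
- exact: powR_ge0.
- by rewrite mulr_ge0 ?powR_ge0//=; case/andP: c01.
- move=> d T Q g mg g0; apply: le_trans (integral_rooted_step_le _ p0 t0 mg g0) _.
  by rewrite EFinM fineK// muleA.
Qed.

End MomentBounds.

(** * Wasserstein distance and contraction *)

Lemma measurable_negative {R : realType} : measurable [set x : R | x < 0].
Proof.
have -> : [set x : R | x < 0] = `]-oo, 0[%classic.
  by apply/seteqP; split=> x /=; rewrite in_itv.
exact: measurable_itv.
Qed.

Section ExtendedLaws.
Context {R : realType}.
Local Open Scope ereal_scope.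
Context {d : measure_display} {Om : measurableType d} (P : probability Om R).

Lemma measurable_fine_fun (S : Om -> \bar R) : measurable_fun setT S ->
  measurable_fun setT (fun w => fine (S w)).
Proof. by move=> mS; apply: (measurableT_comp (f := fine)) => //; exact: fine_measurable. Qed.

(** [fine] sends infinite values to 0, so the two events differ only inside the null set where [S]
    is infinite. *)
Lemma image_EFin_preimage_fine (S : Om -> \bar R) (B : set R) :
  measurable_fun setT S -> measurable B ->
  {ae P, forall w, S w \is a fin_num} ->
  P [set w | (EFin @` B) (S w)] = P [set w | B (fine (S w))].
Proof.
move=> mS mB finS.
pose I := [set w | S w \isn't a fin_num].
have mI : measurable I.
  have := emeasurable_fin_num measurableT mS.
  rewrite setTI => /measurableC; congr measurable.
  by apply/seteqP; split=> w /=; move/negP.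
have PI : P I = 0.
  apply/negligibleP => //; apply: negligibleS finS => w /=.
  by move/negP.
have mE : measurable [set w | (EFin @` B) (S w)].
  rewrite -[X in measurable X]setTI; apply: mS => //.
  exact: measurable_image_EFin.
have mF : measurable [set w | B (fine (S w))].
  rewrite -[X in measurable X]setTI; exact: (measurable_fine_fun mS).
have mFI : measurable ([set w | B (fine (S w))] `&` I) by exact: measurableI.
have -> : [set w | B (fine (S w))] =
    [set w | (EFin @` B) (S w)] `|` ([set w | B (fine (S w))] `&` I).
  apply/seteqP; split=> w /=.
    move=> Bw; have [fw|fw] := boolP (S w \is a fin_num).
      by left; exists (fine (S w)) => //; rewrite fineK.
    by right.
  by case=> [[r Br <-]//|[]].
rewrite measureU0//; apply: subset_measure0 PI => //; exact: subIsetr.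
Qed.

Lemma elaw_fine (S : Om -> \bar R) : measurable_fun setT S ->
  {ae P, forall w, S w \is a fin_num} ->
  exists nu : probability R R, elaw_is P S nu /\
    (forall A, measurable A -> nu A = P [set w | A (fine (S w))]).
Proof.
move=> mS finS.
have [nu nuE] := probability_law P (measurable_fine_fun mS).
exists nu; split=> [B mB|A mA]; last exact: nuE.
by rewrite image_EFin_preimage_fine// nuE.
Qed.

(** Testing [elaw_is] on the whole line shows that the real values of [S] carry the full mass 1. *)
Lemma elaw_fin_num (S : Om -> \bar R) (nu : probability R R) :
  measurable_fun setT S -> elaw_is P S nu ->
  {ae P, forall w, S w \is a fin_num} /\
  (forall A, measurable A -> nu A = P [set w | A (fine (S w))]).
Proof.
move=> mS SE.
have finS : {ae P, forall w, S w \is a fin_num}.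
  have mfin : measurable [set w | S w \is a fin_num].
    by have := emeasurable_fin_num measurableT mS; rewrite setTI.
  have : P [set w | S w \is a fin_num] = 1.
    rewrite -(probability_setT nu) -SE//; congr (P _); apply/seteqP.
    split=> [w Sw|w /= [r _ <-]//].
    by exists (fine (S w)) => //; exact: fineK.
  move=> P1; exists (~` [set w | S w \is a fin_num]); split => //.
    exact: measurableC.
  by rewrite probability_setC// P1 subee.
split=> // A mA.
by rewrite -image_EFin_preimage_fine// SE.
Qed.

Lemma integrable_power_fin_num (S : Om -> \bar R) (p : R) : (0 < p)%R ->
  measurable_fun setT S -> (forall w, 0 <= S w) ->
  \int[P]_w (S w `^ p) < +oo -> {ae P, forall w, S w \is a fin_num}.
Proof.
move=> p0 mS S0 Soo.
have mSp : measurable_fun setT (fun w => S w `^ p).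
  by apply: (measurableT_comp (f := fun y : \bar R => y `^ p)); first exact: measurable_poweR.
have /(integrable_ae measurableT) : P.-integrable setT (fun w => S w `^ p).
  apply/integrableP; split => //.
  by under eq_integral do rewrite gee0_abs ?poweR_ge0//.
apply: filterS => w /(_ I) fw.
rewrite ge0_fin_numE//; apply: (@lty_poweRy _ _ p); first by rewrite gt_eqF.
by rewrite -ge0_fin_numE// poweR_ge0.
Qed.

End ExtendedLaws.

Section WassersteinBounds.
Context {R : realType}.
Local Open Scope ereal_scope.

Lemma ereal_inf_scale (S : set (\bar R)) (k : R) (y : \bar R) : (0 <= k)%R ->
  S !=set0 -> (forall x, S x -> y <= k%:E * x) -> y <= k%:E * ereal_inf S.
Proof.
(* For [k = 0] the factor cannot be divided out; one member of [S] then gives [y <= 0]. *)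
move=> k0 [x0 Sx0] yS; have [k_eq0|k_neq0] := eqVneq k 0%R.
  by move: (yS x0 Sx0); rewrite k_eq0 !mul0e.
have kpos : (0 < k)%R by rewrite lt_neqAle eq_sym k_neq0.
rewrite -lee_pdivrMl//; apply: le_ereal_inf_tmp => x Sx.
by rewrite lee_pdivrMl//; exact: yS.
Qed.

Definition transport_cost (p : R) (pi : probability (R * R)%type R) : \bar R :=
  \int[pi]_z (`|z.1 - z.2| `^ p)%:E.

Lemma measurable_dist_pow (p : R) :
  measurable_fun setT (fun z : R * R => (`|z.1 - z.2| `^ p)%:E).
Proof.
apply/measurable_EFinP.
apply: (measurableT_comp (f := fun y : R => (y `^ p)%R)); first exact: measurable_powR.
apply: (measurableT_comp (f := fun y : R => `|y|%R)); first exact: normr_measurable.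
by apply: measurable_funB.
Qed.

Lemma transport_cost_ge0 p pi : 0 <= transport_cost p pi.
Proof. by apply: integral_ge0 => z _; rewrite lee_fin powR_ge0. Qed.

Lemma dW_ge0 p mu nu : 0 <= @dW R p mu nu.
Proof. by apply: le_ereal_inf_tmp => _ [pi _ <-]; exact: poweR_ge0. Qed.

Lemma coupling_prod (mu nu : probability R R) : coupling mu nu (mu \x nu).
Proof.
move=> A mA; split; rewrite /= product_measure1E//.
  by rewrite [X in _ * X](_ : _ = 1) ?mule1//; exact: probability_setT.
by rewrite [X in X * _](_ : _ = 1) ?mul1e//; exact: probability_setT.
Qed.

Lemma coupling_fst (mu nu : probability R R) pi A : coupling mu nu pi ->
  measurable A -> mu A = pi (fst @^-1` A).
Proof.
move=> c mA; have [<- _] := c A mA; congr (pi _).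
by apply/seteqP; split=> z; [case|].
Qed.

Lemma coupling_snd (mu nu : probability R R) pi A : coupling mu nu pi ->
  measurable A -> nu A = pi (snd @^-1` A).
Proof.
move=> c mA; have [_ <-] := c A mA; congr (pi _).
by apply/seteqP; split=> z; [case|].
Qed.

Lemma measurable_abs_pow (p : R) : measurable_fun setT (fun x : R => (`|x| `^ p)%:E).
Proof.
apply/measurable_EFinP.
apply: (measurableT_comp (f := fun y : R => (y `^ p)%R)); first exact: measurable_powR.
exact: normr_measurable.
Qed.

(** The independent coupling already has finite cost. *)
Lemma dW_fin_num p (mu nu : probability R R) : (1 <= p)%R ->
  Fp p mu -> Fp p nu -> dW p mu nu \is a fin_num.
Proof.
move=> p1 [_ mup] [_ nup].
have p0 : (0 < p)%R by exact: lt_le_trans p1.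
have c := coupling_prod mu nu.
rewrite ge0_fin_numE ?dW_ge0//.
apply: le_lt_trans (ereal_inf_lbound _) _; first by exists (mu \x nu).
apply: poweR_lty.
have E (mu' : probability R R) (f : R * R -> R) : measurable_fun setT f ->
    (forall A, measurable A -> mu' A = (mu \x nu) (f @^-1` A)) ->
    \int[mu \x nu]_z (`|f z| `^ p)%:E = \int[mu']_x (`|x| `^ p)%:E.
  move=> mf mu'E; symmetry.
  apply: (ge0_integral_law (P := (mu \x nu)%E) (f := f)
    (G := fun x => (`|x| `^ p)%:E)) => //.
  exact: measurable_abs_pow.
(* Both constants of [powR_add_le] at [t = 1]. *)
pose C := ((1 + 1) `^ p)%R.
have mabs (f : R * R -> R) : measurable_fun setT f ->
    measurable_fun setT (fun z => (`|f z| `^ p)%:E).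
  by move=> mf; exact: (measurableT_comp (measurable_abs_pow p)).
apply: (@le_lt_trans _ _ (\int[mu \x nu]_z
    (C%:E * (`|z.1| `^ p)%:E + C%:E * (`|z.2| `^ p)%:E))).
  apply: ge0_le_integral => //.
  - exact: measurable_dist_pow.
  - apply: emeasurable_funD; apply: measurable_funeM; exact: mabs.
  - move=> z _; rewrite -!EFinM -EFinD lee_fin.
    apply: (@le_trans _ _ ((`|z.1| + `|z.2|) `^ p)%R).
      apply: ge0_ler_powR; rewrite ?nnegrE ?(ltW p0)//.
      exact: ler_normB.
    by have := @powR_add_le R p 1 `|z.1| `|z.2| p0 ltr01; rewrite invr1; apply.
have C0 : (0 <= C)%R by exact: powR_ge0.
rewrite ge0_integralD//.
- rewrite !ge0_integralZl ?lee_fin//; [|by [exact: mabs|move=> *; rewrite lee_fin powR_ge0]..].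
  rewrite (E mu)//; last by move=> A mA; exact: (coupling_fst c mA).
  rewrite (E nu)//; last by move=> A mA; exact: (coupling_snd c mA).
  by rewrite lte_add_pinfty// lte_mul_pinfty// lee_fin.
- by move=> z _; rewrite mule_ge0 ?lee_fin ?powR_ge0.
- by apply: measurable_funeM; exact: mabs.
- by move=> z _; rewrite mule_ge0 ?lee_fin ?powR_ge0.
- by apply: measurable_funeM; exact: mabs.
Qed.

End WassersteinBounds.

(** * The Wasserstein distance separates laws *)

Section WassersteinSeparation.
Context {R : realType}.
Local Open Scope ereal_scope.

Lemma coupling_swap (mu nu : probability R R) (pi : probability (R * R)%type R) p :
  coupling mu nu pi -> exists pi' : probability (R * R)%type R,
    coupling nu mu pi' /\ transport_cost p pi' = transport_cost p pi.
Proof.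
move=> c; have msw : measurable_fun setT (fun z : R * R => (z.2, z.1)).
  exact: measurable_fun_pair.
have [pi' pi'E] := probability_law pi msw.
exists pi'; split=> [A mA|].
  have [cA1 cA2] := c A mA; rewrite !pi'E; split.
    by rewrite -cA2; congr (pi _); apply/seteqP; split=> z /=; case.
  by rewrite -cA1; congr (pi _); apply/seteqP; split=> z /=; case.
rewrite /transport_cost (ge0_integral_law (P := pi) msw (fun A _ => pi'E A)).
- by apply: eq_integral => z _ /=; rewrite distrC.
- exact: measurable_dist_pow.
- by move=> z; rewrite lee_fin powR_ge0.
Qed.

Lemma dW_sym p (mu nu : probability R R) : dW p mu nu = dW p nu mu.
Proof.
suff le m1 m2 : @dW R p m1 m2 <= dW p m2 m1 by apply/eqP; rewrite eq_le !le.
apply: le_ereal_inf_tmp => _ [pi c <-].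
have [pi' [c' E]] := coupling_swap p c.
by apply: ereal_inf_lbound; exists pi' => //; rewrite -/(transport_cost p pi') E.
Qed.

(** If the second coordinate is at most [x - eps], then the first is below [x] or the two are at
    distance at least [eps]; the Markov inequality bounds the latter event. *)
Lemma coupling_tail_le (mu nu : probability R R) (pi : probability (R * R)%type R)
    (p x eps : R) : (0 < p)%R -> (0 < eps)%R -> coupling mu nu pi ->
  nu `]-oo, (x - eps)%R[%classic <=
  mu `]-oo, x[%classic + ((eps `^ p)^-1)%:E * transport_cost p pi.
Proof.
move=> p0 eps0 c.
pose D := [set z : R * R | (eps <= `|z.1 - z.2|)%R].
have mdist : measurable_fun setT (fun z : R * R => `|z.1 - z.2|%R).
  apply: (measurableT_comp (f := fun y : R => `|y|%R)); first exact: normr_measurable.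
  exact: measurable_funB.
have mD : measurable D.
  rewrite -[D]setTI; exact: measurable_fun_le.
rewrite (coupling_snd c)// (coupling_fst c)//.
have m1 : measurable (fst @^-1` `]-oo, x[%classic : set (R * R)).
  by rewrite -[X in measurable X]setTI; exact: measurable_fst.
have m2 : measurable (snd @^-1` `]-oo, (x - eps)%R[%classic : set (R * R)).
  by rewrite -[X in measurable X]setTI; exact: measurable_snd.
apply: (@le_trans _ _ (pi (fst @^-1` `]-oo, x[%classic `|` D))).
  apply: le_measure; rewrite ?inE//; first exact: measurableU.
  move=> z /=; rewrite !in_itv/= => z2; have [z1|z1] := ltP z.1 x; first by left.
  right; rewrite /D/= ler_normr; apply/orP; left.
  by rewrite lerBrDr (le_trans _ z1)// -lerBrDl ltW.
apply: le_trans (measureU2 _ m1 mD) _; rewrite leeD2l//.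
have epsp : (0 < eps `^ p)%R by rewrite powR_gt0.
rewrite lee_pdivlMl//.
have -> : (eps `^ p)%:E * pi D = \int[pi]_z ((eps `^ p)%:E * (\1_D z)%:E).
  rewrite ge0_integralZl//.
  - by rewrite integral_indic// setIT.
  - by apply/measurable_EFinP; exact: measurable_indic.
  - by rewrite lee_fin ltW.
apply: ge0_le_integral => //.
- by move=> z _; rewrite mule_ge0 ?lee_fin// ltW.
- by apply: measurable_funeM; apply/measurable_EFinP; exact: measurable_indic.
- exact: measurable_dist_pow.
move=> z _; rewrite indicE; have [zD|zD] := boolP (z \in D); last first.
  by rewrite mule0 lee_fin powR_ge0.
rewrite mule1 lee_fin; apply: ge0_ler_powR; rewrite ?nnegrE ?(ltW p0) ?(ltW eps0)//.
by move: zD; rewrite inE.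
Qed.

Lemma dW0_tail_le (mu nu : probability R R) (p x eps : R) : (0 < p)%R ->
  (0 < eps)%R -> dW p mu nu = 0 ->
  nu `]-oo, (x - eps)%R[%classic <= mu `]-oo, x[%classic.
Proof.
move=> p0 eps0 d0; apply/lee_addgt0Pr => del del0.
(* The infimum is only approached. A coupling of cost below [b ^ p = eps ^ p * del] makes the Markov
   term at most [del]. *)
pose b := ((eps `^ p * del) `^ p^-1)%R.
have ed0 : (0 < eps `^ p * del)%R by rewrite mulr_gt0 ?powR_gt0.
have b0 : (0 < b)%R by rewrite powR_gt0.
have [_ [pi c <-] pib] : exists2 y, [set transport_cost p pi `^ p^-1 |
    pi in coupling mu nu] y & y < b%:E.
  apply: contrapT => h; have : b%:E <= dW p mu nu.
    apply: le_ereal_inf_tmp => _ [pi c <-]; rewrite leNgt; apply/negP => lt.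
    by apply: h; exists (transport_cost p pi `^ p^-1) => //; exists pi.
  by rewrite d0 lee_fin leNgt b0.
apply: le_trans (coupling_tail_le _ p0 eps0 c) _.
rewrite leeD2l// lee_pdivrMl ?powR_gt0// -EFinM.
have -> : transport_cost p pi = (transport_cost p pi `^ p^-1) `^ p.
  by rewrite -poweRrM mulVf ?gt_eqF// poweRe1// transport_cost_ge0.
have -> : (eps `^ p * del)%:E = b%:E `^ p.
  by rewrite /b poweR_EFin -powRrM mulVf ?gt_eqF// powRr1// ltW.
by apply: gt0_ler_poweR; rewrite ?(ltW p0)// ?in_itv/= ?leey ?poweR_ge0 ?lee_fin ?(ltW b0)// ltW.
Qed.

(** An open ray is the increasing union of its shifts to the left, so [eps] disappears by continuity
    from below. *)
Lemma dW0_ray_le (mu nu : probability R R) (p x : R) : (0 < p)%R ->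
  dW p mu nu = 0 -> nu `]-oo, x[%classic <= mu `]-oo, x[%classic.
Proof.
move=> p0 d0.
pose F n := `]-oo, (x - n.+1%:R^-1)%R[%classic.
have UF : \bigcup_n F n = `]-oo, x[%classic.
  apply/seteqP; split=> [y [n _]|y] /=; rewrite /F/= !in_itv/= => yx.
    by rewrite (lt_trans yx)// gtrBl invr_gt0.
  have [n nP] : exists n, (n.+1%:R^-1 < x - y)%R.
    have xy0 : (0 < x - y)%R by rewrite subr_gt0.
    exists (Num.truncn (x - y)^-1)%R.
    by rewrite invf_plt ?posrE// truncnS_gt.
  by exists n => //=; rewrite in_itv/= ltrBrDr -ltrBrDl.
have cvgF : (nu \o F) n @[n --> \oo] --> nu (\bigcup_n F n).
  apply: nondecreasing_cvg_mu => //.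
  - by move=> n; exact: measurable_itv.
  - by rewrite UF; exact: measurable_itv.
  - move=> n m nm; rewrite subsetEset => y; rewrite /F/= !in_itv/= => /lt_le_trans; apply.
    by rewrite lerD2l lerN2 lef_pV2 ?posrE// ler_nat.
rewrite -[in leLHS]UF -(cvg_lim _ cvgF)//; apply: lime_le; first by apply/cvg_ex; eexists; exact: cvgF.
apply: nearW => n.
have n0 : (0 < n.+1%:R^-1 :> R)%R by rewrite invr_gt0.
exact: (dW0_tail_le x p0 n0 d0).
Qed.

(** On open rays, a generating class stable under intersection, each law bounds the other because
    the distance is symmetric. *)
Lemma dW0_eq (mu nu : probability R R) (p : R) : (0 < p)%R ->
  dW p mu nu = 0 -> forall A, measurable A -> mu A = nu A.
Proof.
move=> p0 d0.
apply: (measure_unique (@RGenInftyO.G R) (fun n => `]-oo, n%:R[%classic)).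
- exact: RGenInftyO.measurableE.
- move=> _ _ [x ->] [y ->]; exists (Num.min x y).
  by apply/seteqP; split=> z /=; rewrite !in_itv/= lt_min; [move=> [-> ->]|move=> /andP].
- by move=> n; exists n%:R.
- apply/seteqP; split=> // x _; exists (Num.truncn `|x|).+1 => //=.
  rewrite in_itv/=; apply: le_lt_trans (ler_norm x) _.
  exact: truncnS_gt.
- move=> _ [x ->]; apply/eqP; rewrite eq_le; apply/andP; split.
    by apply: (dW0_ray_le _ p0); rewrite dW_sym.
  exact: (dW0_ray_le _ p0).
- by move=> n; apply: le_lt_trans (ltry 1); exact: probability_le1.
Qed.

End WassersteinSeparation.

(** * The recursion map on laws and its contraction *)

Section Contraction.
Context {R : realType} {d0 : measure_display} {O0 : measurableType d0}
  (P0 : probability O0 R) (eta : O0 -> R) (xi : nat -> O0 -> R) (N : O0 -> \bar R).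
Local Open Scope ereal_scope.
Hypothesis mdata : data_meas eta xi N.
Hypothesis eta_ge0 : forall w, (0 <= eta w)%R.
Hypothesis xi_ge0 : forall i w, (0 <= xi i w)%R.

Lemma Trel_leaves (mu nu : probability R R) {d} {T : measurableType d}
    (Q : probability T R) (f : T -> R) : measurable_fun setT f ->
  (forall A, measurable A -> mu A = Q (f @^-1` A)) ->
  Trel P0 eta xi N mu nu ->
  elaw_is (rooted P0 Q) (rooted_step eta xi N (EFin \o f)) nu.
Proof.
move=> mf muQ /TrelP H.
exact: (H _ _ _ _ _ _ _ (rooted_input P0 mdata mf muQ)).
Qed.

Lemma Trel_leaves_intro (mu nu : probability R R) {d} {T : measurableType d}
    (Q : probability T R) (f : T -> R) : measurable_fun setT f ->
  (forall A, measurable A -> mu A = Q (f @^-1` A)) ->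
  elaw_is (rooted P0 Q) (rooted_step eta xi N (EFin \o f)) nu ->
  Trel P0 eta xi N mu nu.
Proof.
move=> mf muQ H.
exact: (Trel_intro (rooted_input P0 mdata mf muQ)).
Qed.

(** Makes [Trel] the graph of a partial map on laws: both outcomes are evaluated on the space with
    leaves of law [mu]. *)
Lemma Trel_functional (mu mu' nu nu' : probability R R) :
  (forall A, measurable A -> mu A = mu' A) ->
  Trel P0 eta xi N mu nu -> Trel P0 eta xi N mu' nu' ->
  forall A, measurable A -> nu A = nu' A.
Proof.
move=> mumu' H H' A mA.
have mE := @measurable_id _ R setT.
have E := Trel_leaves (Q := mu) mE (fun A _ => erefl) H.
have E' := Trel_leaves (Q := mu) mE (fun A mA => esym (mumu' A mA)) H'.
by rewrite -E// -E'.
Qed.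

Lemma measurable_step_EFin {d} {T : measurableType d} (f : T -> R) :
  measurable_fun setT f ->
  measurable_fun setT
    (rooted_step eta xi N (EFin \o f) : O0 * sequences_over T -> \bar R).
Proof. by move=> mf; apply: measurable_rooted_step => //; exact/measurable_EFinP. Qed.

Lemma rooted_step_ge0 {T : Type} (g : T -> \bar R) w :
  0 <= rooted_step eta xi N g w.
Proof. exact: step_ge0. Qed.

(** Leaves with a law in [Fp] are nonnegative only almost surely. Passing to absolute values gives a
    majorant to which the moment estimates apply at every sample. *)
Lemma rooted_step_le_abs (w : O0 * (nat -> R)) :
  rooted_step eta xi N EFin w <= rooted_step eta xi N (fun t => `|t|%:E) w.
Proof.
by apply: le_step => // j _; rewrite lee_fin ler_norm.
Qed.

Section Moments.
Context (p : R).
Hypothesis p1 : (1 <= p)%R.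
Hypothesis etap : \int[P0]_w (eta w `^ p)%:E < +oo.
Hypothesis cp1 : cp P0 xi N p < 1.

Let p0 : (0 < p)%R. Proof. exact: lt_le_trans p1. Qed.

Lemma rooted_step_moment {d} {T : measurableType d} (Q : probability T R)
    (g : T -> \bar R) : measurable_fun setT g -> (forall t, 0 <= g t) ->
  \int[Q]_t (g t `^ p) < +oo ->
  \int[rooted P0 Q]_w (rooted_step eta xi N g w `^ p) < +oo.
Proof.
move=> mg g0 goo.
have [A [r [A0 /andP[r0 _] H]]] := step_moment_contraction mdata eta_ge0 xi_ge0 p0 cp1.
apply: le_lt_trans (H _ _ Q g mg g0) _.
apply: lte_add_pinfty; apply: lte_mul_pinfty; rewrite ?lee_fin//.
Qed.

Let abs_moment (mu : probability R R) : Fp p mu ->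
  \int[rooted P0 mu]_w (rooted_step eta xi N (fun t => `|t|%:E) w `^ p) < +oo.
Proof.
move=> [_ mup]; apply: rooted_step_moment => //.
by apply/measurable_EFinP; exact: normr_measurable.
Qed.

Let meas_abs : measurable_fun setT
  (rooted_step eta xi N (fun t : R => `|t|%:E) : O0 * sequences_over R -> \bar R).
Proof.
by apply: measurable_rooted_step => //; apply/measurable_EFinP; exact: normr_measurable.
Qed.

(** The majorant with absolute leaves has a finite moment, so the step is almost surely finite and
    has a law on [R]. *)
Lemma Trel_exists (mu : probability R R) : Fp p mu ->
  exists nu, Trel P0 eta xi N mu nu.
Proof.
move=> Fmu; have mE := @measurable_id _ R setT.
have fin : {ae rooted P0 mu, forall w, rooted_step eta xi N EFin w \is a fin_num}.
  have := integrable_power_fin_num p0 meas_abs (rooted_step_ge0 _) (abs_moment Fmu).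
  apply: filterS => w; rewrite !ge0_fin_numE ?rooted_step_ge0//.
  exact: le_lt_trans (rooted_step_le_abs w).
have [nu [nuE _]] := elaw_fine (measurable_step_EFin mE) fin.
by exists nu; apply: (Trel_leaves_intro (Q := mu) mE _ nuE).
Qed.

Lemma Trel_Fp (mu nu : probability R R) : Fp p mu ->
  Trel P0 eta xi N mu nu -> Fp p nu.
Proof.
move=> Fmu H; have mE := @measurable_id _ R setT.
have nuE := Trel_leaves (Q := mu) mE (fun A _ => erefl) H.
have mS := measurable_step_EFin mE.
have [_ nuA] := elaw_fin_num mS nuE.
split.
  rewrite nuA; last exact: measurable_negative.
  rewrite (_ : [set w | _] = set0) ?measure0//.
  rewrite -subset0 => w /=; apply/negP; rewrite -leNgt.
  by apply: fine_ge0; exact: rooted_step_ge0.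
rewrite (ge0_integral_law (P := rooted P0 mu) (f := fun w => fine (rooted_step eta xi N EFin w)))//.
- apply: le_lt_trans (abs_moment Fmu).
  have mpow : measurable_fun setT (fun y : \bar R => y `^ p) by exact: measurable_poweR.
  apply: ge0_le_integral => //.
  + apply: (measurableT_comp (measurable_abs_pow p)).
    exact: measurable_fine_fun.
  + exact: (measurableT_comp mpow).
  move=> w _; rewrite -poweR_EFin; apply: gt0_ler_poweR; rewrite ?(ltW p0)// ?in_itv/= ?leey ?andbT ?rooted_step_ge0 ?lee_fin//.
  apply: le_trans (rooted_step_le_abs w).
  rewrite ger0_norm ?fine_ge0 ?rooted_step_ge0//.
  have := rooted_step_ge0 EFin w.
  by case: (rooted_step eta xi N EFin w).
- exact: measurable_fine_fun.
- exact: measurable_abs_pow.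
Qed.

End Moments.

Lemma sup_nn_dist_le (x : nat -> R) (S : set nat) (y z : nat -> R) :
  (forall j, 0 <= x j)%R ->
  sup_nn [set (x j)%:E * (y j)%:E | j in S] <=
  sup_nn [set (x j)%:E * (z j)%:E | j in S] +
  sup_nn [set (x j)%:E * `|y j - z j|%:E | j in S].
Proof.
move=> x0; apply: sup_nn_le; first by rewrite adde_ge0 ?sup_nn_ge0.
move=> _ [j Sj <-].
apply: (@le_trans _ _ ((x j)%:E * (z j)%:E + (x j)%:E * `|y j - z j|%:E)).
  rewrite -!EFinM -EFinD lee_fin -mulrDr ler_wpM2l//.
  by rewrite -lerBlDl ler_norm.
by apply: leeD; apply: sup_nn_ub; exists j.
Qed.

(** The cost cancels in the difference. A one-sided bound suffices, since the leaves can be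
    exchanged. *)
Lemma rooted_step_dist_le {d} {T : measurableType d} (f1 f2 : T -> R) (w : O0 * (nat -> T)) :
  rooted_step eta xi N (EFin \o f1) w \is a fin_num ->
  rooted_step eta xi N (EFin \o f2) w \is a fin_num ->
  `|fine (rooted_step eta xi N (EFin \o f1) w) -
    fine (rooted_step eta xi N (EFin \o f2) w)|%:E <=
  leaf_sup xi N (fun t => `|f1 t - f2 t|%:E) w.
Proof.
suff le (h1 h2 : T -> R) : rooted_step eta xi N (EFin \o h1) w \is a fin_num ->
    rooted_step eta xi N (EFin \o h2) w \is a fin_num ->
    (fine (rooted_step eta xi N (EFin \o h1) w) -
      fine (rooted_step eta xi N (EFin \o h2) w))%:E <=
    leaf_sup xi N (fun t => `|h1 t - h2 t|%:E) w.
  move=> fin1 fin2.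
  have [_|_] := ger0P (fine (rooted_step eta xi N (EFin \o f1) w) -
    fine (rooted_step eta xi N (EFin \o f2) w))%R; first exact: le.
  rewrite opprB; apply: le_trans (le f2 f1 fin2 fin1) _.
  by rewrite (_ : (fun t => `|f2 t - f1 t|%:E) = fun t => `|f1 t - f2 t|%:E)//;
    apply/funext => t; rewrite distrC.
move=> fin1 fin2; rewrite EFinB !fineK// leeBlDl// /rooted_step /step -addeA leeD2l//.
exact: sup_nn_dist_le.
Qed.

(** Take pairs of law [pi] as leaves and run both recursions with the same root data; the joint law
    of the two outcomes is the new coupling. *)
Lemma coupling_step_cost p (mu1 mu2 nu1 nu2 : probability R R)
    (pi : probability (R * R)%type R) : (0 < p)%R ->
  Trel P0 eta xi N mu1 nu1 -> Trel P0 eta xi N mu2 nu2 -> coupling mu1 mu2 pi ->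
  exists2 pi', coupling nu1 nu2 pi' &
    transport_cost p pi' <= cp P0 xi N p * transport_cost p pi.
Proof.
move=> p0 T1 T2 c.
pose S1 : O0 * sequences_over (R * R)%type -> \bar R := rooted_step eta xi N (EFin \o fst).
pose S2 : O0 * sequences_over (R * R)%type -> \bar R := rooted_step eta xi N (EFin \o snd).
have E1 := Trel_leaves (Q := pi) measurable_fst (fun A mA => coupling_fst c mA) T1.
have E2 := Trel_leaves (Q := pi) measurable_snd (fun A mA => coupling_snd c mA) T2.
have mS1 : measurable_fun setT S1 by exact: measurable_step_EFin.
have mS2 : measurable_fun setT S2 by exact: measurable_step_EFin.
have [fin1 nu1E] := elaw_fin_num mS1 E1.
have [fin2 nu2E] := elaw_fin_num mS2 E2.
have mpair : measurable_fun setT (fun w => (fine (S1 w), fine (S2 w))).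
  by apply: measurable_fun_pair; exact: measurable_fine_fun.
have [pi' pi'E] := probability_law (rooted P0 pi) mpair.
exists pi'.
  move=> A mA; rewrite (nu1E A mA) (nu2E A mA) (pi'E (A `*` setT)) (pi'E (setT `*` A)).
  by split; congr (rooted _ _ _); apply/seteqP; split=> w /=; tauto.
rewrite /transport_cost
  (ge0_integral_law (P := rooted P0 pi) mpair (fun A _ => pi'E A)); last 2 first.
- exact: measurable_dist_pow.
- by move=> z; rewrite lee_fin powR_ge0.
have mdist : measurable_fun setT (fun t : R * R => `|t.1 - t.2|%:E).
  apply/measurable_EFinP.
  apply: (measurableT_comp (f := fun y : R => `|y|%R)); first exact: normr_measurable.
  exact: measurable_funB.
have mpow : measurable_fun setT (fun y : \bar R => y `^ p) by exact: measurable_poweR.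
have dist0 (t : R * R) : 0 <= `|t.1 - t.2|%:E by rewrite lee_fin.
have := integral_leaf_sup_le P0 mdata xi_ge0 pi mdist dist0 p0.
under [X in _ <= _ * X -> _]eq_integral do rewrite poweR_EFin.
apply: le_trans.
apply: ae_ge0_le_integral => //.
- exact: (measurableT_comp (measurable_dist_pow p) mpair).
- by move=> w _; exact: poweR_ge0.
- by apply: (measurableT_comp mpow); exact: (measurable_leaf_sup mdata mdist).
apply: filterS2 fin1 fin2 => w fin1 fin2 _ /=.
rewrite -poweR_EFin; apply: gt0_ler_poweR; rewrite ?(ltW p0)// ?in_itv/= ?leey ?andbT ?sup_nn_ge0 ?lee_fin//.
exact: rooted_step_dist_le.
Qed.

Lemma dW_contraction p (mu1 mu2 nu1 nu2 : probability R R) : (1 <= p)%R ->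
  cp P0 xi N p \is a fin_num ->
  Trel P0 eta xi N mu1 nu1 -> Trel P0 eta xi N mu2 nu2 ->
  dW p nu1 nu2 <= (fine (cp P0 xi N p) `^ p^-1)%:E * dW p mu1 mu2.
Proof.
move=> p1 cfin T1 T2; have p0 : (0 < p)%R by exact: lt_le_trans p1.
apply: ereal_inf_scale; first exact: powR_ge0.
  by exists (transport_cost p (mu1 \x mu2) `^ p^-1), (mu1 \x mu2)%E => //; exact: coupling_prod.
move=> _ [pi c <-]; have [pi' c' le] := coupling_step_cost p0 T1 T2 c.
apply: (@le_trans _ _ (transport_cost p pi' `^ p^-1)).
  by apply: ereal_inf_lbound; exists pi'.
apply: (@le_trans _ _ ((cp P0 xi N p * transport_cost p pi) `^ p^-1)).
  apply: gt0_ler_poweR => //; rewrite ?invr_ge0 ?(ltW p0)// in_itv/= leey andbT.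
    exact: transport_cost_ge0.
  by rewrite mule_ge0 ?cp_ge0 ?transport_cost_ge0.
by rewrite poweRM ?cp_ge0 ?transport_cost_ge0// -poweR_EFin fineK.
Qed.

End Contraction.

(** * The law of the tree sum *)

Section ContractionRate.
Context {R : realType}.
Local Open Scope ereal_scope.

Lemma cvge0_eventually_lt (f : nat -> \bar R) (c : R) : (0 < c)%R ->
  f n @[n --> \oo] --> 0 -> exists M, forall n, (M <= n)%N -> f n < c%:E.
Proof.
move=> c0 /fine_cvgP[ffin fcvg].
have fc : \forall n \near \oo, (fine (f n) < c)%R by exact: (cvgr_lt 0%R).
have : \forall n \near \oo, f n < c%:E.
  by apply: filterS2 ffin fc => n fin lt; rewrite -(fineK fin) lte_fin.
by move=> [M _ HM]; exists M.
Qed.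

Context {d0 : measure_display} {O0 : measurableType d0}
  (P0 : probability O0 R) (eta : O0 -> R) (xi : nat -> O0 -> R) (N : O0 -> \bar R).
Hypothesis mdata : data_meas eta xi N.
Hypothesis xi01 : forall i w, (0 <= xi i w < 1)%R.

Let term p i (w : O0) : R :=
  (\1_[set w' | le_star i (N w')] w * (xi i w `^ p))%R.

Let mterm p i : measurable_fun setT (EFin \o term p i).
Proof.
have [_ mx mn] := mdata; apply/measurable_EFinP.
apply: measurable_funM; first by apply: measurable_indic; exact: measurable_le_star.
by apply: (measurableT_comp (f := fun y : R => (y `^ p)%R)); [exact: measurable_powR|exact: mx].
Qed.

Let term_ge0 p i w : (0 <= term p i w)%R.
Proof. by rewrite mulr_ge0 ?powR_ge0. Qed.

Let term_le p q i w : (0 < p)%R -> (p <= q)%R -> (term q i w <= term p i w)%R.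
Proof.
move=> p0 pq; rewrite ler_wpM2l//.
have /andP[x0 x1] := xi01 i w; have [->|xn0] := eqVneq (xi i w) 0%R.
  by rewrite !powR0 ?gt_eqF// (lt_le_trans p0).
by rewrite ger_powR// lt_neqAle eq_sym xn0 x0/= ltW.
Qed.

(** Dominated convergence: raising the exponent by [n] multiplies the term by [xi ^+ n], which tends
    to 0 as [xi < 1], and the term at exponent [p] dominates. *)
Let cvg_term p i : (1 <= p)%R -> cp P0 xi N p < +oo ->
  \int[P0]_w (term (p + n%:R) i w)%:E @[n --> \oo] --> 0.
Proof.
move=> p1 coo; have p0 : (0 < p)%R by exact: lt_le_trans p1.
have -> : (0 : \bar R) = \int[P0]_w (cst 0 w) by rewrite integral0.
apply: (@dominated_cvg _ _ _ P0 setT measurableT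
  (fun n w => (term (p + n%:R) i w)%:E) _ (fun w => (term p i w)%:E)) => //.
- move=> n; exact: mterm.
- move=> w _; rewrite /cst; apply: cvg_EFin; first by apply: nearW.
  have -> : (fine \o (fun n => (term (p + n%:R) i w)%:E)) =
      (fun n => term p i w * (xi i w) ^+ n)%R.
    apply/funext => n /=; rewrite /term -mulrA powRD ?powR_mulrn//.
      by have /andP[] := xi01 i w.
    by apply/implyP; rewrite gt_eqF// ltr_wpDr.
  rewrite -[X in _ --> X](mulr0 (term p i w)); apply: cvgMr.
  by apply: cvg_expr; have /andP[x0 x1] := xi01 i w; rewrite ger0_norm.
- apply/integrableP; split; first exact: mterm.
  under eq_integral do rewrite gee0_abs ?lee_fin//.
  apply: le_lt_trans coo; apply: le_trans (nneseries_lim_ge i.+1 _).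
    rewrite big_mkord (bigD1 ord_max)//= leeDl// sume_ge0// => j _.
    by apply: integral_ge0 => w _; rewrite lee_fin term_ge0.
  by move=> j _ _; apply: integral_ge0 => w _; rewrite lee_fin term_ge0.
- move=> n w _; rewrite gee0_abs ?lee_fin// term_le//.
  by rewrite lerDl.
Qed.

(** Cut the series where its tail at exponent [p] is below one half; larger exponents only shrink
    the tail, while they drive the finite head to 0. The lower bound [q] gives access to moments of
    any order. *)
Lemma exists_cp_lt1 (p q : R) : (1 <= p)%R -> cp P0 xi N p < +oo ->
  exists r, [/\ (1 <= r)%R, (q <= r)%R & cp P0 xi N r < 1].
Proof.
move=> p1 coo; have p0 : (0 < p)%R by exact: lt_le_trans p1.
pose a r i := \int[P0]_w (term r i w)%:E.
have a0 r i : 0 <= a r i by apply: integral_ge0 => w _; rewrite lee_fin.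
have a_le r i : (p <= r)%R -> a r i <= a p i.
  move=> pr; apply: ge0_le_integral => //.
  - by move=> w _; rewrite lee_fin.
  - exact: mterm.
  - exact: mterm.
  - by move=> w _; rewrite lee_fin term_le.
have h2 : (0 < 2^-1 :> R)%R by rewrite invr_gt0.
have := @nneseries_tail_cvg R (a p) xpredT coo (fun k _ => a0 p k).
move=> /(cvge0_eventually_lt h2)[K tailK].
have : \sum_(0 <= i < K) a (p + n%:R)%R i @[n --> \oo] --> 0.
  have sum0 : \sum_(0 <= i < K) (0 : \bar R) = 0 by rewrite big1.
  rewrite -[X in _ --> X]sum0.
  apply: (@cvg_nnesum _ \oo _ R _ (index_iota 0 K)
    (fun i n => a (p + n%:R)%R i) (fun=> 0) xpredT) => i _; first by apply: nearW => n; exact: a0.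
  exact: cvg_term.
move=> /(cvge0_eventually_lt h2)[M headM].
pose n := maxn M (Num.truncn `|q|).+1.
exists (p + n%:R)%R; split.
- by rewrite (le_trans p1)// lerDl.
- apply: (@le_trans _ _ n%:R); last by rewrite lerDr ltW.
  apply: le_trans (ler_norm q) _; apply: (@le_trans _ _ (Num.truncn `|q|).+1%:R).
    by rewrite ltW// truncnS_gt.
  by rewrite ler_nat leq_maxr.
rewrite /cp -/(a _) (nneseries_split 0 K); last by move=> k _; exact: a0.
rewrite add0n.
have -> : (1 : \bar R) = (2^-1)%:E + (2^-1)%:E.
  by rewrite -EFinD -mulr2n -[X in (X *+ 2)%R]mulr1 -mulrnAr mulVf// pnatr_eq0.
apply: lteD.
  by apply: headM; rewrite leq_maxl.
apply: le_lt_trans (tailK K (leqnn K)).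
apply: lee_nneseries => [k _ _|k _]; first exact: a0.
by apply: a_le; rewrite lerDl.
Qed.

End ContractionRate.

Section EqualLaws.
Context {R : realType}.
Local Open Scope ereal_scope.

Lemma ae_forall_countable {d} {Om : measurableType d} (P : probability Om R)
    {I : countType} (Q : I -> Om -> Prop) :
  (forall i, {ae P, forall w, Q i w}) -> {ae P, forall w, forall i, Q i w}.
Proof.
move=> aeQ.
have : {ae P, forall w, forall n,
    if @pickle_inv I n is Some i then Q i w else True}.
  apply: ae_foralln => n; case: pickle_inv => [i|]; first exact: aeQ.
  exact: aeW.
apply: filterS => w Qw i; have := Qw (choice.pickle i).
by rewrite pickleK_inv.
Qed.

Lemma ae_of_probability0 {d} {Om : measurableType d} (P : probability Om R)
    (A : set Om) : measurable A -> P A = 0 -> {ae P, forall w, ~ A w}.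
Proof.
move=> mA PA; exists A; split => // w /=; exact: contrapT.
Qed.

Lemma probability_eq_ae {d} {Om : measurableType d} (P : probability Om R)
    (A B : set Om) : measurable A -> measurable B ->
  {ae P, forall w, A w <-> B w} -> P A = P B.
Proof.
move=> mA mB AB; rewrite -(setIT A) -(setIT B) -!integral_indic//.
apply: ae_eq_integral => //.
- by apply/measurable_EFinP; exact: measurable_indic.
- by apply/measurable_EFinP; exact: measurable_indic.
apply: filterS AB => w AB _; congr (_%:E); rewrite !indicE.
by congr ((_ : bool)%:R); apply/idP/idP => /set_mem h; apply/mem_set; apply/AB.
Qed.

Lemma ge0_integral_eq_law {d1 d2} {O1 : measurableType d1} {O2 : measurableType d2}
    (P1 : probability O1 R) (P2 : probability O2 R) (Y1 : O1 -> \bar R)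
    (Y2 : O2 -> \bar R) (G : \bar R -> \bar R) :
  measurable_fun setT Y1 -> measurable_fun setT Y2 ->
  (forall B, measurable B -> P1 [set w | B (Y1 w)] = P2 [set w | B (Y2 w)]) ->
  measurable_fun setT G -> (forall x, 0 <= G x) ->
  \int[P1]_w G (Y1 w) = \int[P2]_w G (Y2 w).
Proof.
move=> mY1 mY2 Y12 mG G0.
have [nu nuE] := probability_law P1 mY1.
rewrite -(ge0_integral_law (nu := nu) mY1)// -(ge0_integral_law (nu := nu) (P := P2) mY2)//.
by move=> A mA; rewrite nuE; exact: Y12.
Qed.

(** [X - Y] is almost surely nonnegative and has mean 0, the common mean being finite. *)
Lemma ae_eq_of_le_law {d} {Om : measurableType d} (P : probability Om R)
    (mu : probability R R) (X Y : Om -> R) :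
  measurable_fun setT X -> measurable_fun setT Y ->
  (forall A, measurable A -> mu A = P (X @^-1` A)) ->
  (forall A, measurable A -> mu A = P (Y @^-1` A)) ->
  mu.-integrable setT EFin -> {ae P, forall w, (Y w <= X w)%R} ->
  {ae P, forall w, X w = Y w}.
Proof.
move=> mX mY muX muY imu YX.
have iZ (Z : Om -> R) : measurable_fun setT Z ->
    (forall A, measurable A -> mu A = P (Z @^-1` A)) ->
    P.-integrable setT (EFin \o Z) /\ \int[P]_w (Z w)%:E = \int[mu]_x x%:E.
  move=> mZ muZ.
  have mE : measurable_fun setT (EFin : R -> \bar R) by exact/measurable_EFinP/measurable_id.
  have iZ : P.-integrable setT (EFin \o Z).
    apply/integrableP; split; first exact/measurable_EFinP.
    case/integrableP: imu => _.
    rewrite (ge0_integral_law (P := P) mZ)//.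
    exact: measurableT_comp.
  split=> //.
  have := @integral_pushforward _ _ Om R R Z mZ P setT EFin mE.
  rewrite preimage_setT => /(_ iZ measurableT) <-.
  by apply: eq_measure_integral => A mA _; exact: (esym (muZ A mA)).
have [iX XE] := iZ X mX muX; have [iY YE] := iZ Y mY muY.
have mXY : measurable_fun setT (fun w => (X w - Y w)%:E).
  by apply/measurable_EFinP; exact: measurable_funB.
have : \int[P]_w `|(X w - Y w)%:E| = 0.
  transitivity (\int[P]_w ((X w)%:E - (Y w)%:E)).
    apply: ae_eq_integral => //.
    - exact: measurableT_comp.
    apply: filterS YX => w le _.
    by rewrite -EFinB gee0_abs// lee_fin subr_ge0.
  rewrite integralB//= XE YE subee//.
  exact: integrable_fin_num imu.
move/(ae_eq_integral_abs P measurableT mXY); apply: filterS => w /(_ I) [].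
by move=> /eqP; rewrite subr_eq0 => /eqP.
Qed.

End EqualLaws.

Section TreeLaw.
Context {R : realType} {d0 : measure_display} {O0 : measurableType d0}
  (P0 : probability O0 R) (eta : O0 -> R) (xi : nat -> O0 -> R) (N : O0 -> \bar R).
Local Open Scope ereal_scope.
Hypothesis mdata : data_meas eta xi N.
Hypothesis eta_ge0 : forall w, (0 <= eta w)%R.
Hypothesis xi_ge0 : forall i w, (0 <= xi i w)%R.

Notation forest := (infprod P0).

Definition canonical_sum (w : sequences_over O0) : \bar R :=
  path_sup (fun v => eta (node v w)) (fun v j => xi j (node v w))
    (fun v => N (node v w)).

Definition canonical_depth_sum (n : nat) (w : sequences_over O0) : \bar R :=
  depth_sum n (fun v => eta (node v w)) (fun v j => xi j (node v w))
    (fun v => N (node v w)) [::].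

Lemma canonical_tree_data : tree_data P0 eta xi N forest
  (fun v => eta \o node v) (fun v i => xi i \o node v) (fun v => N \o node v).
Proof.
apply: iid_tree_data => // [v|J B mB]; first exact: measurable_node.
exact: node_indep.
Qed.

Lemma graft_tree_data : tree_data P0 eta xi N (rooted P0 forest)
  (fun v => eta \o graft_node v) (fun v i => xi i \o graft_node v)
  (fun v => N \o graft_node v).
Proof.
apply: iid_tree_data => // [v|J B mB]; first exact: measurable_graft_node.
exact: graft_node_indep.
Qed.

Lemma measurable_functional_path_sup : measurable_functional (@path_sup R).
Proof. by move=> d Om e x n m; exact: measurable_path_sup. Qed.

Lemma measurable_functional_depth_sum n :
  measurable_functional (fun e x m => @depth_sum R n e x m [::]).
Proof. by move=> d Om e x m me; exact: measurable_depth_sum. Qed.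

Lemma measurable_canonical_sum : measurable_fun setT canonical_sum.
Proof.
case: canonical_tree_data => m _ _.
exact: (measurable_functional_path_sup m).
Qed.

Lemma measurable_canonical_depth_sum n :
  measurable_fun setT (canonical_depth_sum n).
Proof.
case: canonical_tree_data => m _ _.
exact: (measurable_functional_depth_sum n m).
Qed.

(** The canonical tree and the grafted tree carry data of the same law, and on the grafted tree
    [path_sup_step] exhibits the recursion. *)
Lemma canonical_sum_law B : measurable B ->
  forest [set w | B (canonical_sum w)] =
  rooted P0 forest [set w | B (rooted_step eta xi N canonical_sum w)].
Proof.
move=> mB; have := tree_law_unique measurable_functional_path_sup
  canonical_tree_data graft_tree_data mB.
move=> ->; congr (rooted _ _ _); apply/seteqP.
by split=> w /=; rewrite path_sup_step.
Qed.

Lemma canonical_depth_sum_law n B : measurable B ->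
  forest [set w | B (canonical_depth_sum n.+1 w)] =
  rooted P0 forest [set w | B (rooted_step eta xi N (canonical_depth_sum n) w)].
Proof.
move=> mB; have := tree_law_unique (measurable_functional_depth_sum n.+1)
  canonical_tree_data graft_tree_data mB.
move=> ->; congr (rooted _ _ _); apply/seteqP.
by split=> w; rewrite /mkset depth_sumS.
Qed.

Let node_data_ge0 (w : sequences_over O0) :
  nonneg_data (fun v => eta (node v w)) (fun v j => xi j (node v w)).
Proof. by split=> [v|v j]. Qed.

Lemma canonical_sum_ge0 w : 0 <= canonical_sum w.
Proof. exact: path_sup_ge0. Qed.

Lemma canonical_depth_sum_ge0 n w : 0 <= canonical_depth_sum n w.
Proof. exact: depth_sum_ge0. Qed.

Lemma canonical_depth_sum_le n w : canonical_depth_sum n w <= canonical_sum w.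
Proof. exact: depth_sum_le_path_sup. Qed.

Lemma cvg_canonical_depth_sum w :
  canonical_depth_sum n w @[n --> \oo] --> canonical_sum w.
Proof. exact: cvg_depth_sum. Qed.

Section Moments.
Context (q : R).
Hypothesis q1 : (1 <= q)%R.
Hypothesis etaq : \int[P0]_w (eta w `^ q)%:E < +oo.
Hypothesis cq1 : cp P0 xi N q < 1.

Let q0 : (0 < q)%R. Proof. exact: lt_le_trans q1. Qed.

Let mpow : measurable_fun setT (fun y : \bar R => y `^ q).
Proof. exact: measurable_poweR. Qed.

Lemma canonical_depth_sum_moment_bound : exists K : R,
  forall n, \int[forest]_w (canonical_depth_sum n w `^ q) <= K%:E.
Proof.
have [A [r [A0 /andP[r0 r1] H]]] := step_moment_contraction mdata eta_ge0 xi_ge0 q0 cq1.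
have eta_fin : \int[P0]_w (eta w `^ q)%:E \is a fin_num.
  by rewrite ge0_fin_numE// integral_ge0// => w _; rewrite lee_fin powR_ge0.
pose E := fine (\int[P0]_w (eta w `^ q)%:E).
have E0 : (0 <= E)%R.
  by rewrite fine_ge0// integral_ge0// => w _; rewrite lee_fin powR_ge0.
have r1' : (0 < 1 - r)%R by rewrite subr_gt0.
(* The fixed point of the affine map [m -> A * E + r * m], hence a bound that the recursion
   preserves. *)
exists (A * E / (1 - r))%R; elim=> [|n IH].
  rewrite integral0_eq; last by move=> w _; apply: poweR0r; rewrite gt_eqF.
  by rewrite lee_fin divr_ge0 ?mulr_ge0// ltW.
rewrite (ge0_integral_eq_law (P2 := rooted P0 forest)
  (Y2 := rooted_step eta xi N (canonical_depth_sum n))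
  (measurable_canonical_depth_sum n.+1) _ _ mpow)//.
- apply: le_trans (H _ _ _ _ (measurable_canonical_depth_sum n)
    (canonical_depth_sum_ge0 n)) _.
  apply: (@le_trans _ _ (A%:E * E%:E + r%:E * (A * E / (1 - r))%:E)).
    by rewrite fineK// leeD2l// lee_wpmul2l.
  rewrite -!EFinM -EFinD lee_fin -subr_ge0.
  suff -> : (A * E / (1 - r) - (A * E + r * (A * E / (1 - r))) = 0)%R by [].
  rewrite opprD addrCA -{1}(mul1r (A * E / (1 - r)))%R -mulrBl.
  by rewrite mulrCA mulfV ?gt_eqF// mulr1 addNr.
- by apply: measurable_rooted_step => //; exact: measurable_canonical_depth_sum.
- by move=> B mB; exact: canonical_depth_sum_law.
- by move=> x; exact: poweR_ge0.
Qed.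

Lemma canonical_sum_moment : \int[forest]_w (canonical_sum w `^ q) < +oo.
Proof.
have [K HK] := canonical_depth_sum_moment_bound.
pose g n w := canonical_depth_sum n w `^ q.
have mg n : measurable_fun setT (g n).
  exact: (measurableT_comp mpow (measurable_canonical_depth_sum n)).
have g0 n w : 0 <= g n w by exact: poweR_ge0.
have gnd w : {homo g^~ w : n m / (n <= m)%N >-> n <= m}.
  move=> n m nm; apply: gt0_ler_poweR; rewrite ?(ltW q0)// ?in_itv/= ?leey ?andbT ?canonical_depth_sum_ge0//.
  exact: (nondecreasing_depth_sum _ _ (node_data_ge0 w)).
have mcv := monotone_convergence forest measurableT mg (fun n w _ => g0 n w)
  (fun w _ => gnd w).
(* The power passes through the increasing limit because both [y ^ q] and its inverse are
   monotone. *)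
have gE w : limn (g^~ w) = canonical_sum w `^ q.
  have cg : cvgn (g^~ w) by apply: ereal_nondecreasing_is_cvgn; exact: gnd.
  apply/eqP; rewrite eq_le; apply/andP; split.
    apply: lime_le => //; apply: nearW => n.
    apply: gt0_ler_poweR; rewrite ?(ltW q0)// ?in_itv/= ?leey ?andbT ?canonical_depth_sum_ge0 ?canonical_sum_ge0//.
    exact: canonical_depth_sum_le.
  have s0 : 0 <= limn (g^~ w) by apply: lime_ge => //; apply: nearW.
  have -> : limn (g^~ w) = (limn (g^~ w) `^ q^-1) `^ q.
    by rewrite -poweRrM mulVf ?gt_eqF// poweRe1.
  apply: gt0_ler_poweR; rewrite ?(ltW q0)// ?in_itv/= ?leey ?andbT ?canonical_sum_ge0 ?poweR_ge0//.
  rewrite -(cvg_lim _ (cvg_canonical_depth_sum (w := w)))//; apply: lime_le.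
    by apply/cvg_ex; eexists; exact: cvg_canonical_depth_sum.
  apply: nearW => n.
  have -> : canonical_depth_sum n w = (g n w) `^ q^-1.
    by rewrite -poweRrM mulfV ?gt_eqF// poweRe1// canonical_depth_sum_ge0.
  apply: gt0_ler_poweR; rewrite ?invr_ge0 ?(ltW q0)// ?in_itv/= ?leey ?andbT//.
  apply: lime_ge => //; exists n => // m /= nm; exact: gnd.
apply: le_lt_trans (ltry K).
under eq_integral do rewrite -gE.
rewrite mcv; apply: lime_le; last by apply: nearW.
apply: ereal_nondecreasing_is_cvgn => n m nm.
by apply: ge0_le_integral => // w _; exact: gnd.
Qed.

Lemma canonical_sum_fin_num : {ae forest, forall w, canonical_sum w \is a fin_num}.
Proof.
exact: (integrable_power_fin_num q0 measurable_canonical_sum canonical_sum_ge0 canonical_sum_moment).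
Qed.

End Moments.

End TreeLaw.

(** * The tree law as a fixed point and as the limit of iterates *)

Section FixedPoint.
Context {R : realType} {d0 : measure_display} {O0 : measurableType d0}
  (P0 : probability O0 R) (eta : O0 -> R) (xi : nat -> O0 -> R) (N : O0 -> \bar R).
Local Open Scope ereal_scope.
Hypothesis mdata : data_meas eta xi N.
Hypothesis eta_ge0 : forall w, (0 <= eta w)%R.
Hypothesis xi_ge0 : forall i w, (0 <= xi i w)%R.

Notation forest := (infprod P0).
Notation tree_sup := (canonical_sum eta xi N).
Notation depth_sup := (canonical_depth_sum eta xi N).

(** [Trel] asks for real leaves, while [g] may be infinite. Replacing [g] by [fine] of it alters the
    step only where one of countably many leaves is infinite, which is a null event. *)
Lemma Trel_of_law (mu nu : probability R R) {d d'} {T : measurableType d}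
    {O1 : measurableType d'} (Q : probability T R) (P1 : probability O1 R)
    (g : T -> \bar R) (h : O1 -> \bar R) :
  measurable_fun setT g -> {ae Q, forall t, g t \is a fin_num} ->
  (forall A, measurable A -> mu A = Q [set t | A (fine (g t))]) ->
  (forall B, measurable B ->
    P1 [set w | B (h w)] = rooted P0 Q [set w | B (rooted_step eta xi N g w)]) ->
  elaw_is P1 h nu -> Trel P0 eta xi N mu nu.
Proof.
move=> mg fing muE hE nuE.
have mf : measurable_fun setT (fun t => fine (g t)) by exact: measurable_fine_fun.
apply: (Trel_leaves_intro (Q := Q) mdata mf muE) => B mB.
rewrite -nuE// hE; last exact: measurable_image_EFin.
have mEB : measurable (EFin @` B : set (\bar R)) by exact: measurable_image_EFin.
apply: probability_eq_ae.
- rewrite -[X in measurable X]setTI; apply: measurable_step_EFin => //.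
- rewrite -[X in measurable X]setTI; exact: measurable_rooted_step.
have fin_leaf : {ae rooted P0 Q, forall w, forall j, g (w.2 j) \is a fin_num}.
  apply: ae_foralln => j.
  have mfin : measurable [set t | ~ (g t \is a fin_num)].
    have := emeasurable_fin_num measurableT mg.
    by rewrite setTI => /measurableC.
  have leaf0 : rooted P0 Q [set w | ~ (g (w.2 j) \is a fin_num)] = 0.
    rewrite (rooted_leaf P0 Q j mfin).
    exact/(negligibleP _ mfin).
  have mleaf : measurable [set w : O0 * sequences_over T | ~ (g (w.2 j) \is a fin_num)].
    rewrite -[X in measurable X]setTI.
    by have := measurable_leaf (O0 := O0) j measurableT mfin.
  by apply: filterS (ae_of_probability0 mleaf leaf0) => w /= /contrapT.
have FF : Filter (almost_everywhere (rooted P0 Q)) by exact: ae_filter_ringOfSetsType.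
apply: (@filterS _ _ FF _ _ _ fin_leaf) => w finw.
suff E : rooted_step eta xi N (EFin \o (fun t => fine (g t))) w =
  rooted_step eta xi N g w by rewrite /mkset E.
rewrite /rooted_step; congr (step _ _ _ _); apply/funext => j /=.
by rewrite fineK.
Qed.

Section Solution.
Hypothesis eta_moments :
  forall q, (1 <= q)%R -> \int[P0]_w (eta w `^ q)%:E < +oo.
Hypothesis rates : forall q : R, exists r, [/\ (1 <= r)%R, (q <= r)%R & cp P0 xi N r < 1].

Let fin_tree : {ae forest, forall w, tree_sup w \is a fin_num}.
Proof.
have [r [r1 _ cr]] := rates 1.
exact: (canonical_sum_fin_num mdata eta_ge0 xi_ge0 r1 (eta_moments r1) cr).
Qed.

Let mtree : measurable_fun setT tree_sup.
Proof. exact: (measurable_canonical_sum P0 mdata). Qed.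

Let mdepth n : measurable_fun setT (depth_sup n).
Proof. exact: (measurable_canonical_depth_sum P0 mdata). Qed.

Let fin_depth n : {ae forest, forall w, depth_sup n w \is a fin_num}.
Proof.
apply: filterS fin_tree => w.
rewrite !ge0_fin_numE ?canonical_sum_ge0 ?canonical_depth_sum_ge0//.
by apply: le_lt_trans; exact: canonical_depth_sum_le.
Qed.

Context (mu : probability R R).
Hypothesis mu_law : elaw_is forest tree_sup mu.

Let muE A : measurable A -> mu A = forest [set w | A (fine (tree_sup w))].
Proof. by move=> mA; have [_ ->] := elaw_fin_num mtree mu_law. Qed.

Lemma Trel_tree_law : Trel P0 eta xi N mu mu.
Proof.
apply: (Trel_of_law mtree fin_tree muE _ mu_law) => B mB.
exact: canonical_sum_law.
Qed.

Let mu_ge0 : mu [set x | (x < 0)%R] = 0.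
Proof.
rewrite muE; last exact: measurable_negative.
rewrite [X in forest X](_ : _ = set0); last first.
  rewrite -subset0 => w /=; apply/negP; rewrite -leNgt.
  by apply: fine_ge0; exact: canonical_sum_ge0.
exact: measure0.
Qed.

Let mfine : measurable_fun setT (fun w => fine (tree_sup w)).
Proof. exact: measurable_fine_fun. Qed.

Lemma tree_law_Fp p : (1 <= p)%R -> Fp p mu.
Proof.
move=> p1; split; first exact: mu_ge0.
(* [c(p)] itself may exceed 1, so the bound is taken at a larger exponent and brought down by
   [|x| ^ p <= 1 + |x| ^ q]. *)
have [q [q1 pq cq]] := rates p.
have q0 : (0 < q)%R by exact: lt_le_trans q1.
have p0 : (0 < p)%R by exact: lt_le_trans p1.
have muq : \int[mu]_x (`|x| `^ q)%:E < +oo.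
  rewrite (ge0_integral_law (P := forest) mfine)//; last exact: measurable_abs_pow.
  apply: le_lt_trans (canonical_sum_moment mdata eta_ge0 xi_ge0 q1 (eta_moments q1) cq).
  apply: ge0_le_integral => //.
  - exact: (measurableT_comp (measurable_abs_pow q) mfine).
  - by apply: (measurableT_comp (f := fun y : \bar R => y `^ q)) => //; exact: measurable_poweR.
  move=> w _; rewrite -poweR_EFin; have : 0 <= tree_sup w by exact: canonical_sum_ge0.
  case: (tree_sup w) => [t t0||//]; first by rewrite /= ger0_norm.
  by move=> _; rewrite [fine _]/= normr0 poweR_EFin powR0 ?gt_eqF// poweR_ge0.
apply: (@le_lt_trans _ _ (\int[mu]_x (1%:E + (`|x| `^ q)%:E))).
  apply: ge0_le_integral => //.
  - exact: measurable_abs_pow.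
  - by apply: emeasurable_funD => //; exact: measurable_abs_pow.
  move=> x _; rewrite -EFinD lee_fin; have [x1|x1] := leP 1%R `|x|%R.
    by apply: (le_trans (ler_powR x1 pq)); rewrite lerDr.
  apply: (@le_trans _ _ 1%R); last by rewrite lerDl powR_ge0.
  have -> : 1%R = (1 `^ p)%R :> R by rewrite powR1.
  by apply: ge0_ler_powR; rewrite ?nnegrE ?(ltW p0)// ltW.
rewrite ge0_integralD//; last exact: measurable_abs_pow.
rewrite integral_cst// mul1e; apply: lte_add_pinfty => //.
by apply: le_lt_trans (ltry 1); exact: probability_le1.
Qed.

Lemma Tchain_exists_law : exists nu, Tchain P0 eta xi N \d_(0%R : R) nu /\
  (forall n A, measurable A -> nu n A = forest [set w | A (fine (depth_sup n w))]).
Proof.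
have /choice[nu nuP] : forall n, exists nu : probability R R,
    elaw_is forest (depth_sup n) nu /\
    (forall A, measurable A -> nu A = forest [set w | A (fine (depth_sup n w))]).
  by move=> n; exact: elaw_fine.
exists nu; split=> [|n]; last exact: (nuP n).2.
split=> [A mA|n]; last first.
  apply: (Trel_of_law (mdepth n) (fin_depth n) (nuP n).2 _ (nuP n.+1).1) => B mB.
  exact: canonical_depth_sum_law.
rewrite (nuP 0%N).2// diracE; have [A0|A0] := boolP (0%R \in A).
  rewrite -(probability_setT forest); congr (forest _); apply/seteqP; split=> // w _.
  exact: set_mem A0.
rewrite [X in forest X](_ : _ = set0) ?measure0// -subset0 => w Aw.
by move/negP: A0; apply; exact: mem_set.
Qed.

Lemma Tchain_functional nu nu' mu0 mu0' :
  (forall A, measurable A -> mu0 A = mu0' A) ->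
  Tchain P0 eta xi N mu0 nu -> Tchain P0 eta xi N mu0' nu' ->
  forall n A, measurable A -> nu n A = nu' n A.
Proof.
move=> mu00 [nu0 nuS] [nu'0 nu'S]; elim=> [A mA|n IH].
  by rewrite nu0// nu'0// mu00.
exact: (Trel_functional mdata IH (nuS n) (nu'S n)).
Qed.

(** Any chain started at 0 has the laws of the truncated sums. These converge almost surely on one
    space, and bounded test functions allow dominated convergence there. *)
Lemma Tchain_weak_cvg nu : Tchain P0 eta xi N \d_(0%R : R) nu -> weak_cvg nu mu.
Proof.
have [can canP] := Tchain_exists_law; move=> [nu0 nuS].
have nuE := Tchain_functional (fun A _ => erefl) (conj nu0 nuS) canP.1.
move=> f cf [M fM].
have mf : measurable_fun setT f by exact: continuous_measurable_fun.
have M0 : (0 <= M)%R by exact: le_trans (fM 0%R).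
have law (m : probability R R) (Z : sequences_over O0 -> R) :
    measurable_fun setT Z ->
    (forall A, measurable A -> m A = forest (Z @^-1` A)) ->
    \int[m]_x (f x)%:E = \int[forest]_w (f (Z w))%:E.
  move=> mZ mE.
  have mfE : measurable_fun setT (fun x : R => (f x)%:E) by exact/measurable_EFinP.
  have ifZ : forest.-integrable setT ((fun x : R => (f x)%:E) \o Z).
    apply: (@le_integrable _ _ _ forest setT measurableT _ (cst M%:E)).
    - exact: (measurableT_comp mfE).
    - by move=> w _ /=; rewrite lee_fin (ger0_norm M0).
    - exact: finite_measure_integrable_cst.
  have := @integral_pushforward _ _ _ R R Z mZ forest setT _ mfE.
  rewrite preimage_setT => /(_ ifZ measurableT) <-.
  by apply: eq_measure_integral => A mA _; exact: mE.
rewrite (law mu (fun w => fine (tree_sup w)))//.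
have -> : (fun n => \int[nu n]_x (f x)%:E) =
    (fun n => \int[forest]_w (f (fine (depth_sup n w)))%:E).
  apply/funext => n; apply: law; first exact: measurable_fine_fun.
  by move=> A mA; rewrite nuE// canP.2.
have mfd n : measurable_fun setT (fun w => (f (fine (depth_sup n w)))%:E).
  apply/measurable_EFinP; apply: (measurableT_comp mf); exact: measurable_fine_fun.
have mfl : measurable_fun setT (fun w => (f (fine (tree_sup w)))%:E).
  by apply/measurable_EFinP; apply: (measurableT_comp mf).
have cvf : {ae forest, forall w, setT w ->
    (f (fine (depth_sup n w)))%:E @[n --> \oo] --> (f (fine (tree_sup w)))%:E}.
  apply: filterS fin_tree => w fin _.
  apply: cvg_EFin; first exact: nearW.
  apply: (@cvg_comp _ _ _ (fun n => fine (depth_sup n w)) f _ _ _ _ (cf _)).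
  by apply: fine_cvg; rewrite fineK//; exact: cvg_canonical_depth_sum.
have iM : forest.-integrable setT (cst M%:E).
  exact: finite_measure_integrable_cst.
have dom : {ae forest, forall w, forall n : nat, setT w ->
    `|(f (fine (depth_sup n w)))%:E| <= cst M%:E w}.
  by apply: aeW => w n _; rewrite lee_fin.
have [_ _] := dominated_convergence measurableT mfd mfl cvf iM dom.
exact.
Qed.

End Solution.
End FixedPoint.

(** * Endogeny *)

Section Endogeny.
Context {R : realType} {d0 : measure_display} {O0 : measurableType d0}
  (P0 : probability O0 R) (eta : O0 -> R) (xi : nat -> O0 -> R) (N : O0 -> \bar R).
Local Open Scope ereal_scope.
Hypothesis mdata : data_meas eta xi N.
Hypothesis eta_ge0 : forall w, (0 <= eta w)%R.
Hypothesis xi_ge0 : forall i w, (0 <= xi i w)%R.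
Context (mu : probability R R).
Hypothesis mu_law : elaw_is (infprod P0) (canonical_sum eta xi N) mu.
Hypothesis mu_Fp : Fp 1 mu.

Section OnTree.
Context {d : measure_display} {Om : measurableType d} (P : probability Om R)
  (etaT : seq nat -> Om -> R) (xiT : seq nat -> nat -> Om -> R)
  (NT : seq nat -> Om -> \bar R).
Hypothesis td : tree_data P0 eta xi N P etaT xiT NT.

Lemma measurable_tree_sum : measurable_fun setT (tree_sum etaT xiT NT).
Proof. by case: td => m _ _; exact: (measurable_path_sup m). Qed.

Lemma tree_sum_law : elaw_is P (tree_sum etaT xiT NT) mu.
Proof.
move=> B mB; rewrite -mu_law//.
apply: (tree_law_unique measurable_functional_path_sup td
  (canonical_tree_data P0 mdata)).
exact: measurable_image_EFin.
Qed.

Lemma tree_sum_lty : {ae P, forall om, tree_sum etaT xiT NT om < +oo}.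
Proof.
have [+ _] := elaw_fin_num measurable_tree_sum tree_sum_law.
by apply: filterS => w fw; rewrite ltey_eq fw.
Qed.

(** [same_data_law] carries the signs of the base data to each vertex as null events, and there are
    countably many vertices and labels. *)
Lemma tree_data_ge0 : {ae P, forall om, nonneg_data (etaT^~ om) (fun v j => xiT v j om)}.
Proof.
case: td => m same _; pose neg := `]-oo, 0%R[%classic : set R.
have mneg : measurable neg by exact: measurable_itv.
have ae_eta v : {ae P, forall om, (0 <= etaT v om)%R}.
  have [me _ _] := m v.
  have P0v : P (etaT v @^-1` neg) = 0.
    have := same v 0%N neg (fun=> setT) setT mneg (fun=> measurableT) measurableT.
    have -> : data_event (etaT v) (xiT v) (NT v) 0 neg (fun=> setT) setT =
        etaT v @^-1` neg by apply/seteqP; split=> w; [case|split].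
    move=> <-; rewrite (_ : data_event _ _ _ _ _ _ _ = set0) ?measure0//.
    rewrite -subset0 => w [+ _ _]; rewrite /neg/= in_itv/= => /lt_geF.
    by rewrite eta_ge0.
  have mv : measurable (etaT v @^-1` neg).
    by rewrite -[X in measurable X]setTI; exact: me.
  apply: filterS (ae_of_probability0 mv P0v) => w /=.
  by rewrite /neg/= in_itv/= => /negP; rewrite -leNgt.
have ae_xi v j : {ae P, forall om, (0 <= xiT v j om)%R}.
  have [_ mx _] := m v.
  have P0v : P (xiT v j @^-1` neg) = 0.
    have mB i : measurable ((if i == j then neg else setT) : set R) by case: ifP.
    have := same v j.+1 setT (fun i => if i == j then neg else setT) setT
      measurableT mB measurableT.
    have -> : data_event (etaT v) (xiT v) (NT v) j.+1 setT
        (fun i => if i == j then neg else setT) setT = xiT v j @^-1` neg.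
      apply/seteqP; split=> w.
        by case=> _ /(_ j (ltnSn j)); rewrite eqxx.
      by move=> wj; split=> // i _; case: eqP => // ->.
    move=> <-; rewrite (_ : data_event _ _ _ _ _ _ _ = set0) ?measure0//.
    rewrite -subset0 => w [_ /(_ j (ltnSn j)) + _].
    by rewrite eqxx /neg/= in_itv/= => /lt_geF; rewrite xi_ge0.
  have mv : measurable (xiT v j @^-1` neg).
    by rewrite -[X in measurable X]setTI; exact: mx.
  apply: filterS (ae_of_probability0 mv P0v) => w /=.
  by rewrite /neg/= in_itv/= => /negP; rewrite -leNgt.
have := ae_forall_countable ae_eta.
have := ae_forall_countable (fun v => ae_foralln (ae_xi v)).
by apply: filterS2 => w hx he; split.
Qed.

(** Measurability of the path supremum is applied with the sigma-algebra generated by the data as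
    the ambient one. *)
Lemma tree_sum_generated : measurable_wrt
  <<s \bigcup_(w in [set: seq nat]) data_gens (etaT w) (xiT w) (NT w) >>
  (fun om => fine (tree_sum etaT xiT NT om)).
Proof.
set G := \bigcup_(w in _) _.
have mG A : G A -> measurable (A : set (g_sigma_algebraType G)).
  exact: sub_sigma_algebra.
have m v : @data_meas R _ (g_sigma_algebraType G) (etaT v) (xiT v) (NT v).
  split=> [|j|] _ B mB; rewrite setTI; apply: mG; exists v => //.
  - by left; left; exists B.
  - by left; right; exists j => //; exists B.
  - by right; exists B.
move=> B mB.
have := @measurable_fine_fun R _ (g_sigma_algebraType G) _ (measurable_path_sup m).
by move=> /(_ measurableT B mB); rewrite setTI.
Qed.

End OnTree.

Lemma tree_law_endogenous : endogenous P0 eta xi N mu.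
Proof.
move=> d Om P etaT xiT NT X [td mX lawX eqX _].
exists (fun om => fine (tree_sum etaT xiT NT om)).
split; first exact: tree_sum_generated.
have mT := measurable_tree_sum td.
have [fin_sum sum_law] := elaw_fin_num mT (tree_sum_law td).
apply: (@ae_eq_of_le_law _ _ _ P mu) => //.
- exact: measurable_fine_fun.
- by move=> A mA; rewrite -(lawX [::]).
- case: mu_Fp => _ mu1; apply/integrableP; split.
    exact/measurable_EFinP/measurable_id.
  by under eq_integral do rewrite abse_EFin -(powRr1 (normr_ge0 _)).
have X_ge0 : {ae P, forall om, forall v, (0 <= X v om)%R}.
  apply: ae_forall_countable => v.
  have mneg := @measurable_negative R.
  have Xneg : P (X v @^-1` [set x : R | (x < 0)%R]) = 0.
    by rewrite lawX//; case: mu_Fp.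
  have mv : measurable (X v @^-1` [set x : R | (x < 0)%R]).
    by rewrite -[X in measurable X]setTI; exact: mX.
  apply: filterS (ae_of_probability0 mv Xneg) => w /=.
  by move/negP; rewrite -leNgt.
have eqs := ae_forall_countable eqX.
have le_sum : {ae P, forall om, tree_sum etaT xiT NT om <= (X [::] om)%:E}.
  (* Outside one null set the recursion holds at all vertices at once, so the deterministic
     comparison applies sample by sample. *)
  apply: filterS3 X_ge0 eqs (tree_data_ge0 td) => om X0 eqom ge0om.
  rewrite tree_sumE.
  by apply: (path_sup_le_fix (Y := fun v => (X v om)%:E)).
apply: filterS2 fin_sum le_sum => om fin le.
by rewrite -lee_fin fineK.
Qed.

End Endogeny.

(** * Reduction to everywhere nonnegative data *)

Section DataLaw.
Context {R : realType} {d0 : measure_display} {O0 : measurableType d0}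
  (P0 : probability O0 R).
Local Open Scope ereal_scope.

Section Transport.
Context (eta eta' : O0 -> R) (xi xi' : nat -> O0 -> R) (N : O0 -> \bar R).
Hypothesis same : same_data_law P0 eta xi N P0 eta' xi' N.

Lemma same_data_law_congr {d} {Om : measurableType d} (P : probability Om R) e x n :
  same_data_law P0 eta xi N P e x n <-> same_data_law P0 eta' xi' N P e x n.
Proof.
split=> h k B0 B BN mB0 mB mBN; first by rewrite -same// h.
by rewrite same// h.
Qed.

Lemma Trel_congr mu nu : Trel P0 eta xi N mu nu <-> Trel P0 eta' xi' N mu nu.
Proof.
split=> T d Om P e x n X m mX s; apply: T => //; exact/same_data_law_congr.
Qed.

Lemma Tchain_congr mu0 nu : Tchain P0 eta xi N mu0 nu <-> Tchain P0 eta' xi' N mu0 nu.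
Proof. by split=> -[nu0 nuS]; split=> // n; exact/Trel_congr. Qed.

Lemma tree_data_congr {d} {Om : measurableType d} (P : probability Om R) e x n :
  tree_data P0 eta xi N P e x n <-> tree_data P0 eta' xi' N P e x n.
Proof. by split=> -[m s i]; split=> // v; exact/same_data_law_congr. Qed.

Lemma endogenous_congr mu : endogenous P0 eta' xi' N mu -> endogenous P0 eta xi N mu.
Proof.
move=> E d Om P e x n X [td mX lX eX iX]; apply: E.
by split; [exact/tree_data_congr|exact: mX|exact: lX|exact: eX|exact: iX].
Qed.

End Transport.

Context (eta : O0 -> R) (xi : nat -> O0 -> R) (N : O0 -> \bar R).
Hypothesis mdata : data_meas eta xi N.
Hypothesis good :
  {ae P0, forall w, (0 <= eta w)%R /\ (forall i, (0 <= xi i w < 1)%R)}.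

(* The sign conditions hold only almost surely; clipping makes them hold
   everywhere without changing the joint law of the data. *)
Definition clip_cost (w : O0) : R := Num.max 0%R (eta w).
Definition clip_weight (i : nat) (w : O0) : R :=
  if (0 <= xi i w < 1)%R then xi i w else 0%R.

Lemma clip_cost_ge0 w : (0 <= clip_cost w)%R.
Proof. by rewrite le_max lexx. Qed.

Lemma clip_weight01 i w : (0 <= clip_weight i w < 1)%R.
Proof. by rewrite /clip_weight; case: ifP => // _; rewrite lexx ltr01. Qed.

Lemma clip_data_meas : data_meas clip_cost clip_weight N.
Proof.
have [me mx mn] := mdata; split=> // [|i].
  exact: measurable_maxr.
apply: measurable_fun_ifT => //.
by apply: measurable_and; [exact: measurable_fun_ler|exact: measurable_fun_ltr].
Qed.

Lemma clip_ae : {ae P0, forall w, clip_cost w = eta w /\ forall i, clip_weight i w = xi i w}.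
Proof.
apply: filterS good => w [e0 x01]; split; first exact/max_idPr.
by move=> i; rewrite /clip_weight x01.
Qed.

Lemma clip_same_law : same_data_law P0 eta xi N P0 clip_cost clip_weight N.
Proof.
move=> n B0 B BN mB0 mB mBN; apply: probability_eq_ae.
- exact: measurable_data_event.
- by apply: measurable_data_event => //; exact: clip_data_meas.
apply: filterS clip_ae => w [e x]; rewrite /data_event/= e.
by split=> -[h0 h hN]; split=> // i /h; rewrite x.
Qed.

Lemma clip_cp p : cp P0 clip_weight N p = cp P0 xi N p.
Proof.
have mterm x i : (forall j, measurable_fun setT (x j)) ->
    measurable_fun setT (fun w : O0 => (\1_[set w' | le_star i (N w')] w * (x i w `^ p))%:E).
  move=> mx; case: mdata => _ _ mn; apply/measurable_EFinP.
  apply: measurable_funM; first by apply: measurable_indic; exact: measurable_le_star.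
  by apply: (measurableT_comp (f := fun y : R => (y `^ p)%R)); [exact: measurable_powR|exact: mx].
apply: eq_eseriesr => i _; apply: ge0_ae_eq_integral => //.
- by apply: mterm; case: clip_data_meas.
- by apply: mterm; case: mdata.
- by move=> w _; rewrite lee_fin mulr_ge0 ?powR_ge0.
- by move=> w _; rewrite lee_fin mulr_ge0 ?powR_ge0.
by apply: filterS clip_ae => w [_ x] _; rewrite x.
Qed.

Lemma clip_moment p :
  \int[P0]_w (clip_cost w `^ p)%:E = \int[P0]_w (eta w `^ p)%:E.
Proof.
have mterm (e : O0 -> R) : measurable_fun setT e ->
    measurable_fun setT (fun w => (e w `^ p)%:E).
  move=> me; apply/measurable_EFinP.
  by apply: (measurableT_comp (f := fun y : R => (y `^ p)%R)); first exact: measurable_powR.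
apply: ge0_ae_eq_integral => //.
- by apply: mterm; case: clip_data_meas.
- by apply: mterm; case: mdata.
- by move=> w _; rewrite lee_fin powR_ge0.
- by move=> w _; rewrite lee_fin powR_ge0.
by apply: filterS clip_ae => w [e _] _; rewrite e.
Qed.

End DataLaw.

(** * Uniqueness and convergence of iterates *)

Section ContractionConsequences.
Context {R : realType} {d0 : measure_display} {O0 : measurableType d0}
  (P0 : probability O0 R) (eta : O0 -> R) (xi : nat -> O0 -> R) (N : O0 -> \bar R).
Local Open Scope ereal_scope.
Hypothesis mdata : data_meas eta xi N.
Hypothesis eta_ge0 : forall w, (0 <= eta w)%R.
Hypothesis xi_ge0 : forall i w, (0 <= xi i w)%R.
Context (mu : probability R R) (p : R).
Hypothesis p1 : (1 <= p)%R.
Hypothesis etap : \int[P0]_w (eta w `^ p)%:E < +oo.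
Hypothesis cp1 : cp P0 xi N p < 1.
Hypothesis mu_fix : Trel P0 eta xi N mu mu.
Hypothesis mu_Fp : Fp p mu.

Let p0 : (0 < p)%R. Proof. exact: lt_le_trans p1. Qed.

Let k := (fine (cp P0 xi N p) `^ p^-1)%R.

Let cfin : cp P0 xi N p \is a fin_num.
Proof. exact: cp_fin_num. Qed.

Let k01 : (0 <= k < 1)%R.
Proof.
have : (fine (cp P0 xi N p) `^ p^-1 < 1 `^ p^-1)%R.
  apply: gt0_ltr_powR; rewrite ?invr_gt0 ?nnegrE ?fine_ge0 ?cp_ge0//.
  by rewrite -lte_fin fineK.
by rewrite powR1 /k => ->; rewrite powR_ge0.
Qed.

Lemma dW_fix_le (nu nu' : probability R R) : Trel P0 eta xi N nu nu' ->
  dW p nu' mu <= k%:E * dW p nu mu.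
Proof. by move=> T; apply: (dW_contraction mdata) => //; exact: mu_fix. Qed.

(** The distance [r] between two solutions in [Fp] is finite and satisfies [r <= k * r] with
    [k < 1], which forces [r = 0]. *)
Lemma fixed_point_unique (nu : probability R R) : Fp p nu ->
  Trel P0 eta xi N nu nu -> forall A, measurable A -> nu A = mu A.
Proof.
move=> Fnu Tnu; apply: (dW0_eq p0).
have := dW_fix_le Tnu; have := dW_fin_num p1 Fnu mu_Fp.
have := dW_ge0 p nu mu; case: (dW p nu mu) => // r r0 _.
rewrite -EFinM !lee_fin in r0 * => rk; congr (_%:E); apply/eqP.
rewrite eq_le r0 andbT leNgt; apply/negP => rpos.
have /andP[_ k1] := k01.
by move: rk; rewrite leNgt => /negP; apply; rewrite gtr_pMl.
Qed.

Lemma Tchain_dW_cvg (nu0 : probability R R) (nu : nat -> probability R R) :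
  Fp p nu0 -> Tchain P0 eta xi N nu0 nu ->
  dW p (nu n) mu @[n --> \oo] --> 0.
Proof.
move=> [neg0 mom0] [nu00 nuS].
have mneg := @measurable_negative R.
(* [Tchain] fixes its start only through the values on measurable sets, so membership in [Fp] has to
   be carried over. *)
have Fnu0 : Fp p (nu 0%N).
  split; first by rewrite nu00.
  by rewrite (eq_measure_integral nu0)// => A mA _; exact: nu00.
have dfin := dW_fin_num p1 Fnu0 mu_Fp.
pose D := fine (dW p (nu 0%N) mu).
have /andP[k0 k1] := k01.
have bound n : dW p (nu n) mu <= (k ^+ n * D)%:E.
  elim: n => [|n IH]; first by rewrite expr0 mul1r fineK.
  apply: le_trans (dW_fix_le (nuS n)) _.
  by rewrite exprS -mulrA EFinM lee_wpmul2l.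
apply: (@squeeze_cvge _ _ _ _ (cst 0) _ (fun n => (k ^+ n * D)%:E)).
- by apply: nearW => n; rewrite dW_ge0 bound.
- exact: cvg_cst.
apply: cvg_EFin; first exact: nearW.
rewrite -[X in _ --> X](mul0r D); apply: cvgMl.
by apply: cvg_expr; rewrite ger0_norm.
Qed.

End ContractionConsequences.

Theorem theorem32 (R : realType) (d0 : measure_display) (O0 : measurableType d0)
  (P0 : probability O0 R) (eta : O0 -> R) (xi : nat -> O0 -> R)
  (N : O0 -> \bar R) :
  data_meas eta xi N ->
  (forall w, N w = +oo%E \/ exists n : nat, N w = (n%:R)%:E) ->
  {ae P0, forall w, 0 <= eta w /\ (forall i, 0 <= xi i w < 1)} ->
  (forall p : R, 1 <= p -> (\int[P0]_w ((eta w) `^ p)%:E < +oo)%E) ->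
  (exists p : R, 1 <= p /\ (cp P0 xi N p < +oo)%E) ->
  exists mu : probability R R,
    (* (a) *)
    ((forall p : R, 1 <= p -> Fp p mu) /\
     [/\ Trel P0 eta xi N mu mu,
        endogenous P0 eta xi N mu,
        ((exists nu, Tchain P0 eta xi N \d_(0 : R) nu) /\
         (forall nu, Tchain P0 eta xi N \d_(0 : R) nu -> weak_cvg nu mu)) &
        (forall (d : measure_display) (Om : measurableType d)
           (P : probability Om R) etaT xiT NT,
           tree_data P0 eta xi N P etaT xiT NT ->
           {ae P, forall om, (tree_sum etaT xiT NT om < +oo)%E} /\
           elaw_is P (tree_sum etaT xiT NT) mu)]) /\
    (* (b) *)
     forall p : R, 1 <= p -> (cp P0 xi N p < 1)%E ->
       [/\ (forall mu1, Fp p mu1 ->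
              (exists nu1, Trel P0 eta xi N mu1 nu1) /\
              (forall nu1, Trel P0 eta xi N mu1 nu1 -> Fp p nu1)),
           (forall mu1 mu2 nu1 nu2, Fp p mu1 -> Fp p mu2 ->
              Trel P0 eta xi N mu1 nu1 -> Trel P0 eta xi N mu2 nu2 ->
              (dW p nu1 nu2 <= ((fine (cp P0 xi N p)) `^ p^-1)%:E * dW p mu1 mu2)%E),
           (forall nu, Fp p nu -> Trel P0 eta xi N nu nu ->
              forall A, measurable A -> nu A = mu A) &
           (forall mu0 : probability R R, Fp p mu0 ->
              forall nu, Tchain P0 eta xi N mu0 nu ->
                (fun n => dW p (nu n) mu) @ \oo --> 0%E)].
Proof.
move=> mdata _ good eta_mom [p0 [p01 cp0]].
(* From here on everything is proved for the clipped data and carried back through equality of the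
   data laws. *)
have same := clip_same_law mdata good.
have mdata' := clip_data_meas mdata.
have eta'0 := clip_cost_ge0 eta.
have xi'01 := clip_weight01 xi.
have xi'0 i w : 0 <= clip_weight xi i w by have /andP[] := xi'01 i w.
have etam p : 1 <= p -> (\int[P0]_w (clip_cost eta w `^ p)%:E < +oo)%E.
  by move=> p1; rewrite (clip_moment mdata good); exact: eta_mom.
have cpE := clip_cp mdata good.
have rates q : exists r, [/\ 1 <= r, q <= r & (cp P0 (clip_weight xi) N r < 1)%E].
  by apply: (exists_cp_lt1 mdata' xi'01 q p01); rewrite cpE.
have [r [r1 _ cr]] := rates 1.
have [mu [mu_law _]] := elaw_fine (measurable_canonical_sum P0 mdata')
  (canonical_sum_fin_num mdata' eta'0 xi'0 r1 (etam r r1) cr).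
have mu_Fp p : 1 <= p -> Fp p mu.
  by move=> p1; exact: (tree_law_Fp mdata' eta'0 xi'0 etam rates mu_law p1).
have mu_fix := Trel_tree_law mdata' eta'0 xi'0 etam rates mu_law.
exists mu; split; first split => //.
  split.
  - exact/(Trel_congr same).
  - apply: (endogenous_congr same).
    exact: (tree_law_endogenous mdata' eta'0 xi'0 mu_law (mu_Fp 1 (lexx 1))).
  - split.
      have [nu [nuT _]] := Tchain_exists_law mdata' eta'0 xi'0 etam rates.
      by exists nu; exact/(Tchain_congr same).
    move=> nu /(Tchain_congr same) nuT.
    exact: (Tchain_weak_cvg mdata' eta'0 xi'0 etam rates mu_law nuT).
  - move=> d Om P etaT xiT NT /(tree_data_congr same) td; split.
      exact: (tree_sum_lty mdata' mu_law td).
    exact: (tree_sum_law mdata' mu_law td).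
move=> p p1; rewrite -cpE => cp1.
have cfin := cp_fin_num cp1.
have etap := etam p p1.
split.
- move=> mu1 F1; split.
    have [nu1 T1] := Trel_exists mdata' eta'0 xi'0 p1 etap cp1 F1.
    by exists nu1; exact/(Trel_congr same).
  move=> nu1 /(Trel_congr same) T1.
  exact: (Trel_Fp mdata' eta'0 xi'0 p1 etap cp1 F1 T1).
- move=> mu1 mu2 nu1 nu2 _ _ /(Trel_congr same) T1 /(Trel_congr same) T2.
  exact: (dW_contraction mdata' xi'0 p1 cfin T1 T2).
- move=> nu Fnu /(Trel_congr same) Tnu.
  exact: (fixed_point_unique mdata' xi'0 p1 cp1 mu_fix (mu_Fp p p1) Fnu Tnu).
- move=> mu0 F0 nu /(Tchain_congr same) nuT.
  exact: (Tchain_dW_cvg mdata' xi'0 p1 cp1 mu_fix (mu_Fp p p1) F0 nuT).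
Qed.
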